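(* Consider the problem $\Psi^*=\min_{x\in X}\{\Psi(x)=f(x)+\mathcal{X}(x)\}$, where $f$ satisfies $\|f'(y)-f'(x)\|\le H\|y-x\|^\nu$ on $X$ for some $H>0$ and $\nu\in[0,1]$, and let the feasible set $X$ be bounded. Let the UAPL algorithm (described in the context) be applied to it, and let $\epsilon>0$. (a) Suppose that $\Psi$ is bounded below over $X$, i.e., $\Psi^*$ is finite, that $\nu\in(0,1]$, and that the initial stepsizes satisfy $\hat\beta_k\ge(2\sigma-\gamma)/L(\nu,H)$ for all $k\ge1$. Then there is a constant $C>0$ depending only on $\nu,\sigma,\gamma,\gamma_2$ such that the total number of iterations (counted by $k$) performed by the UAPL method to have $\|g_{X,k}\|^2\le\epsilon$ for at least one $k$ is bounded by $$\left\lceil C\,H^{\frac1\nu}\left[\frac{\Psi(p_0)-\Psi^*+1}{\epsilon}\right]^{\frac{1+\nu}{2\nu}}\right\rceil.$$ (b) Suppose that $f$ is convex and an optimal solution $x^*$ exists for the problem $\min_{x\in X}\Psi(x)$. Then the number of phases performed by the UAPL method to find a solution $\bar x\in X$ such that $\Psi(\bar x)-\Psi(x^* )\le\epsilon$ is bounded by $$S(\epsilon)=\left\lceil\max\left\{0,\log_{\frac1q}\frac{H\max_{x,y\in X}\|x-y\|^{1+\nu}}{(1+\nu)\epsilon}\right\}\right\rceil,\qquad\text{where } q=1-\frac12\min\{\eta,1-\eta\}.$$ In addition, by choosing $\alpha_t=2/(t+1)$ for any $t\ge1$, the total number of iterations to find the aforementioned solution $\bar x$ is bounded by $$S(\epsilon)+\frac{1}{1-q^{\frac{2}{3\nu+1}}}\left(\frac{4\sqrt3\,H\max_{x,y\in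 X}\|x-y\|^{1+\nu}}{\eta\theta(1+\nu)\epsilon}\right)^{\frac{2}{3\nu+1}},\qquad\text{with }\theta=\tfrac12.$$
   Context: Setting: $X\subseteq\mathbb{R}^n$ is a closed convex set, $f:X\to\mathbb{R}$ is possibly nonconvex with gradient $f'$ (in the case $\nu=0$, nonsmooth convex $f$ with $f'(x)$ a subgradient is also allowed), $\mathcal{X}$ is a (possibly nondifferentiable) convex real-valued function on $X$, $\Psi:=f+\mathcal{X}$, and $\Psi^*:=\min_{x\in X}\Psi(x)$ denotes the optimal value. $\|\cdot\|$ is the Euclidean norm and $\|x\|_G=\sqrt{\langle Gx,x\rangle}$ for positive definite $G$. There are $H>0$, $\nu\in[0,1]$ with $\|f'(y)-f'(x)\|\le H\|y-x\|^\nu$ for all $x,y\in X$; consequently $|f(y)-f(x)-\langle f'(x),y-x\rangle|\le\frac{H}{1+\nu}\|y-x\|^{1+\nu}$. All minimizers over $X$ or its closed convex subsets appearing below are assumed to exist when the feasible set is nonempty. $L(\nu,H)=\left\{\frac{H}{2[(1+\nu)/(1-\nu)]^{(1-\nu)/2}}\right\}^{2/(1+\nu)}$ for $\nu\in[0,1)$, and $L(1,H)=H/2$. For $x,y\in X$, $h(y,x)=f(y)+\langle f'(y),x-y\rangle+\mathcal{X}(x)$. For a compact convex set $X'\subseteq X$, $\underline h(y)=\min\{h(y,x):x\in X'\}$ ($=+\infty$ if $X'=\emptyset$). Gradient step $\mathrm{GS}(k)$: given $x^{ag}_{k-1}\in X$, line search parameters $0<\gamma<\sigma<1$ and $\gamma_2\in(0,1)$,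 choose an initial stepsize $\hat\beta_k>0$ and a symmetric matrix $G_k\succeq\sigma I$, and find the smallest integer $\tau_{2,k}\ge0$ such that with $\beta_k=\hat\beta_k\gamma_2^{\tau_{2,k}}$ and $\bar x^{ag}_k=\arg\min_{u\in X}\{\langle f'(x^{ag}_{k-1}),u\rangle+\frac1{2\beta_k}\|u-x^{ag}_{k-1}\|_{G_k}^2+\mathcal{X}(u)\}$ one has $\Psi(\bar x^{ag}_k)\le\Psi(x^{ag}_{k-1})-\frac{\gamma}{2\beta_k}\|\bar x^{ag}_k-x^{ag}_{k-1}\|^2+\frac1k$. The projected gradient is $g_{X,k}:=(x^{ag}_{k-1}-\bar x^{ag}_k)/\beta_k$. UAPL algorithm. Input: $p_0\in X$; $\{\alpha_t\}_{t\ge 1}$ with $\alpha_1=1$ and $\alpha_t\in(0,1)$ for $t\ge2$; $\eta\in(0,1)$. Set $p_1\in\operatorname{Argmin}_{x\in X}h(p_0,x)$, $\mathrm{lb}_1=h(p_0,p_1)$, $x^{ag}_0=p_0$, $k=0$. For $s=1,2,\ldots$ (each $s$ is a phase): set $\hat x^{ag}_0=p_s$, $\bar\Psi_0=\Psi(\hat x^{ag}_0)$, $\underline\Psi_0=\mathrm{lb}_s$, $l=\eta\underline\Psi_0+(1-\eta)\bar\Psi_0$; choose $x_0\in X$ and the initial localizer $X'_0$ arbitrarily (say $x_0=p_s$, $X'_0=X$), where a localizer is a compact convex set $X'_0$ with $\{x\in X:\Psi(x)\le l\}\subseteq X'_0\subseteq X$. For $t=1,2,\ldots$ (each is one iteration):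 1. $x^{md}_t=(1-\alpha_t)\hat x^{ag}_{t-1}+\alpha_tx_{t-1}$ and $\underline\Psi_t=\max\{\underline\Psi_{t-1},\min\{l,\underline h(x^{md}_t)\}\}$, with $\underline h$ defined using $X'=X'_{t-1}$. 2. $x_t=\arg\min_{x\in X'_{t-1}}\{\|x-x_0\|^2:h(x^{md}_t,x)\le l\}$; if this problem is infeasible, set $x_t=\hat x^{ag}_{t-1}$. 3. Set $k\leftarrow k+1$; set $\tilde x^{ag}_t=(1-\alpha_t)\hat x^{ag}_{t-1}+\alpha_tx_t$ and compute $\bar x^{ag}_k$ by $\mathrm{GS}(k)$; choose $\hat x^{ag}_t\in\{\hat x^{ag}_{t-1},\tilde x^{ag}_t,\bar x^{ag}_k\}$ with $\Psi(\hat x^{ag}_t)=\min\{\Psi(\hat x^{ag}_{t-1}),\Psi(\tilde x^{ag}_t),\Psi(\bar x^{ag}_k)\}$. Set $\bar\Psi_t=\Psi(\hat x^{ag}_t)$ and $x^{ag}_k=\hat x^{ag}_t$. 4. If $\underline\Psi_t\le\bar\Psi_t$ and $\bar\Psi_t-\underline\Psi_t\le[1-\frac12\min\{\eta,1-\eta\}](\bar\Psi_0-\underline\Psi_0)$, terminate this phase and set $p_{s+1}=\hat x^{ag}_t$, $\mathrm{lb}_{s+1}=\underline\Psi_t$. 5. Otherwise choose an arbitrary compact convex set $X'_t$ with $\underline X_t\subseteq X'_t\subseteq\bar X_t$, where $\underline X_t=\{x\in X'_{t-1}:h(x^{md}_t,x)\le l\}$ and $\bar X_t=\{x\in X:\langle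 x_t-x_0,x-x_t\rangle\ge0\}$. *)

(* Defs.v *)
From HB Require Import structures.
From mathcomp Require Import all_boot all_order all_algebra.
From mathcomp Require Import all_classical all_reals all_analysis.

Set Implicit Arguments.
Unset Strict Implicit.
Unset Printing Implicit Defensive.

Import Order.TTheory GRing.Theory Num.Theory.
Import numFieldNormedType.Exports.

Local Open Scope classical_set_scope.
Local Open Scope ring_scope.

Section Euclidean.
Context {R : realType} {n : nat}.
Implicit Types (u v : 'rV[R]_n) (G : 'M[R]_n).

Definition dot u v : R := \sum_i u ord0 i * v ord0 i.

(* The library norm on 'rV[R]_n is the sup norm. *)
Definition enorm u : R := Num.sqrt (dot u u).

Definition gnorm G u : R := Num.sqrt (dot (u *m G) u).

(* G is symmetric and G - c I is positive semidefinite. *)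
Definition sym_ge G (c : R) :=
  G^T = G /\ forall u, c * dot u u <= dot (u *m G) u.

Definition is_argmin (A : set 'rV[R]_n) (F : 'rV[R]_n -> R) u :=
  A u /\ forall v, A v -> F u <= F v.

(* Differentiability is relative to X, since f is a function on X only. *)
Definition is_gradient (X : set 'rV[R]_n) (f : 'rV[R]_n -> R)
    (df : 'rV[R]_n -> 'rV[R]_n) :=
  forall x, X x -> forall e : R, 0 < e ->
    \forall y \near x, X y ->
      `|f y - f x - dot (df x) (y - x)| <= e * enorm (y - x).

Definition is_subgradient (X : set 'rV[R]_n) (f : 'rV[R]_n -> R)
    (df : 'rV[R]_n -> 'rV[R]_n) :=
  forall x y, X x -> X y -> f x + dot (df x) (y - x) <= f y.

(* max_(x, y in X) |x - y|^(1 + nu); the supremum is attained since X is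
   compact wherever this is used. *)
Definition diam_pow (X : set 'rV[R]_n) (nu : R) : R :=
  sup [set enorm (x - y) `^ (1 + nu) | x in X & y in X].

End Euclidean.

(* The constant L(nu, H). *)
Definition Lconst {R : realType} (nu H : R) : R :=
  if nu == 1 then H / 2
  else (H / (2 * ((1 + nu) / (1 - nu)) `^ ((1 - nu) / 2))) `^ (2 / (1 + nu)).

Record composite_problem {R : realType} {n : nat} (X : set 'rV[R]_n)
    (f : 'rV[R]_n -> R) (df : 'rV[R]_n -> 'rV[R]_n) (chi : 'rV[R]_n -> R)
    (nu H : R) : Prop := {
  cp_closed : closed X;
  cp_convex : convex_set X;
  cp_chi_convex : convex_function X chi;
  cp_H_gt0 : 0 < H;
  cp_nu_itv : 0 <= nu <= 1;
  cp_gradient : is_gradient X f df \/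
    [/\ nu = 0, convex_function X f & is_subgradient X f df];
  cp_hoelder : forall x y, X x -> X y ->
    enorm (df y - df x) <= H * enorm (y - x) `^ nu
}.

Section UAPL.
Context {R : realType} {n : nat}.
Local Notation V := 'rV[R]_n.
Variables (X : set V) (f : V -> R) (df : V -> V) (chi : V -> R).
Variables (sigma gamma gamma2 eta : R) (alpha : nat -> R).

Definition Psi (x : V) : R := f x + chi x.

(* The optimal value; an infimum, so that it makes sense as soon as Psi is
   bounded below on X. *)
Definition Psi_opt : R := inf [set Psi x | x in X].

Definition hlin (y x : V) : R := f y + dot (df y) (x - y) + chi x.

(* Equals +oo when X' is empty. *)
Definition hmin (X' : set V) (y : V) : \bar R :=
  ereal_inf [set (hlin y x)%:E | x in X'].

Record gstep := GStep {
  gs_hbeta : R;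
  gs_G : 'M[R]_n;
  gs_tau : nat;
  gs_xbar : V
}.

Definition gs_beta (g : gstep) : R := gs_hbeta g * gamma2 ^+ gs_tau g.

Definition prox_obj (z : V) (G : 'M[R]_n) (beta : R) (u : V) : R :=
  dot (df z) u + gnorm G (u - z) ^+ 2 / (2 * beta) + chi u.

Definition ls_accept (k : nat) (z : V) (beta : R) (u : V) :=
  Psi u <= Psi z - gamma / (2 * beta) * enorm (u - z) ^+ 2 + k%:R^-1.

(* GS(k) started from z = x^ag_(k-1); each of the rejected trials
   tau' < gs_tau g produced a minimizer that failed the test. *)
Definition gradient_step (k : nat) (z : V) (g : gstep) :=
  [/\ 0 < gs_hbeta g,
      sym_ge (gs_G g) sigma,
      is_argmin X (prox_obj z (gs_G g) (gs_beta g)) (gs_xbar g),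
      ls_accept k z (gs_beta g) (gs_xbar g) &
      forall tau', (tau' < gs_tau g)%N ->
        let beta := gs_hbeta g * gamma2 ^+ tau' in
        exists2 u, is_argmin X (prox_obj z (gs_G g) beta) u
                 & ~ ls_accept k z beta u].

(* State between two iterations, t iterations having been done in the current
   phase s. *)
Record state := State {
  phase : nat;       (* s *)
  inner : nat;       (* t *)
  xag : V;           (* x^ag_k, k the total number of iterations done *)
  xhat : V;          (* \hat x^ag_t; differs from xag only when k = 0 *)
  xorig : V;         (* x_0 *)
  xcur : V;          (* x_t *)
  loc : set V;       (* X'_t *)
  lb0 : R;           (* \underline\Psi_0 *)
  ub0 : R;           (* \bar\Psi_0 *)
  lb : R             (* \underline\Psi_t *)
}.

Definition level (st : state) : R := eta * lb0 st + (1 - eta) * ub0 st.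

Definition qfactor : R := 1 - 2^-1 * Num.min eta (1 - eta).

Definition start_phase (s : nat) (xa p : V) (lo : R) (st : state) : Prop :=
  [/\ [/\ phase st = s, inner st = 0%N, xag st = xa & xhat st = p],
      [/\ lb0 st = lo, ub0 st = Psi p & lb st = lo],
      X (xorig st), xcur st = xorig st &
      [/\ compact (loc st), convex_set (loc st),
          [set x | X x /\ Psi x <= level st] `<=` loc st & loc st `<=` X]].

(* The k-th iteration, from st to st'. *)
Definition iteration (k : nat) (g : gstep) (st st' : state) : Prop :=
  let t := (inner st).+1 in
  let l := level st in
  let xmd := (1 - alpha t) *: xhat st + alpha t *: xcur st in
  let sub := [set x | loc st x /\ hlin xmd x <= l] in
  exists (lbt : R) (xt xh : V),
  let xtilde := (1 - alpha t) *: xhat st + alpha t *: xt in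
  [/\ lbt%:E = maxe (lb st)%:E (mine l%:E (hmin (loc st) xmd)),
      (sub !=set0 -> is_argmin sub (fun x => enorm (x - xorig st) ^+ 2) xt) /\
      (sub = set0 -> xt = xhat st),
      gradient_step k (xag st) g,
      [\/ xh = xhat st, xh = xtilde | xh = gs_xbar g] /\
      Psi xh = Num.min (Psi (xhat st)) (Num.min (Psi xtilde) (Psi (gs_xbar g)))
    & let stop := lbt <= Psi xh /\
                  Psi xh - lbt <= qfactor * (ub0 st - lb0 st) in
      (stop /\ start_phase (phase st).+1 xh xh lbt st') \/
      (~ stop /\
        [/\ [/\ phase st' = phase st, inner st' = t, xag st' = xh
              & xhat st' = xh],
            xorig st' = xorig st, xcur st' = xt,
            [/\ lb0 st' = lb0 st, ub0 st' = ub0 st & lb st' = lbt]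
          & [/\ compact (loc st'), convex_set (loc st'), sub `<=` loc st' &
                loc st' `<=`
                  [set x | X x /\ 0 <= dot (xt - xorig st) (x - xt)]]])].

(* st k is the state after k iterations, g k the gradient step performed during
   the k-th one (k >= 1). *)
Definition uapl_run (p0 : V) (st : nat -> state) (g : nat -> gstep) : Prop :=
  [/\ X p0,
      alpha 1%N = 1 /\ (forall t, (2 <= t)%N -> 0 < alpha t < 1),
      0 < eta < 1,
      (exists2 p1, is_argmin X (hlin p0) p1 &
        start_phase 1 p0 p1 (hlin p0 p1) (st 0%N))
    & forall k, iteration k.+1 (g k.+1) (st k) (st k.+1)].

(* g_(X,k), for k >= 1 *)
Definition proj_grad (st : nat -> state) (g : nat -> gstep) (k : nat) : V :=
  (gs_beta (g k))^-1 *: (xag (st k.-1) - gs_xbar (g k)).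

Definition eps_solution (xstar : V) (eps : R) (x : V) :=
  X x /\ Psi x - Psi xstar <= eps.

End UAPL.

(* S(eps). If X is a singleton the logarithm is ln 0 = 0 instead of -oo, which
   gives the same maximum with 0. *)
Definition phase_bound {R : realType} {n : nat} (X : set 'rV[R]_n)
    (nu H eta eps : R) : int :=
  Num.ceil (Num.max 0
    (ln (H * diam_pow X nu / ((1 + nu) * eps)) / ln (qfactor eta)^-1)).

(* Main.v *)
(* (a) An accepted gradient step lowers Psi by a multiple of beta_k |g_k|^2, up
   to 1/k, and the Hoelder condition keeps beta_k above a multiple of
   H^(-2/(1+nu)) k^(-(1-nu)/(1+nu)).  Summing over K/2 < k <= K only, so that the
   errors 1/k add up to at most 1, bounds the number K of steps with
   |g_k|^2 > eps.
   (b) A phase multiplies the gap between the bounds on Psi^* by q, which bounds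
   the number of phases.  Inside a phase with gap Delta, x_t lies in the half space
   <x_(t-1) - x_0, x - x_(t-1)> >= 0, so that the squares |x_t - x_(t-1)|^2 add up
   to at most |x_t - x_0|^2; with Hoelder's inequality this makes
   Psi(xhat_t) - l decrease like t^(-(1+3nu)/2), and the phase lasts at most
   1 + (c / Delta)^(2/(3nu+1)) iterations.  These bounds form a geometric series
   in the phases. *)
Require Import Defs.
From HB Require Import structures.
From mathcomp Require Import all_boot all_order all_algebra.
From mathcomp Require Import all_classical all_reals all_analysis.
From mathcomp Require Import ring lra zify.

Set Implicit Arguments.
Unset Strict Implicit.
Unset Printing Implicit Defensive.

Import Order.TTheory GRing.Theory Num.Theory.
Import numFieldNormedType.Exports.

Local Open Scope classical_set_scope.
Local Open Scope ring_scope.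

(** * Euclidean geometry *)

Section Geometry.
Context {R : realType} {n : nat}.
Implicit Types (u v w : 'rV[R]_n) (G : 'M[R]_n) (a c t : R).

Lemma dotC u v : dot u v = dot v u.
Proof. by apply: eq_bigr => i _; rewrite mulrC. Qed.

Lemma dotDl u v w : dot (u + v) w = dot u w + dot v w.
Proof. by rewrite -big_split; apply: eq_bigr => i _; rewrite mxE mulrDl. Qed.

Lemma dotZl a u v : dot (a *: u) v = a * dot u v.
Proof. by rewrite /dot mulr_sumr; apply: eq_bigr => i _; rewrite mxE mulrA. Qed.

Lemma dot0l u : dot 0 u = 0.
Proof. by rewrite -(scale0r (0 : 'rV[R]_n)) dotZl mul0r. Qed.

Lemma dotNl u v : dot (- u) v = - dot u v.
Proof. by rewrite -scaleN1r dotZl mulN1r. Qed.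

Lemma dotBl u v w : dot (u - v) w = dot u w - dot v w.
Proof. by rewrite dotDl dotNl. Qed.

Lemma dotDr u v w : dot u (v + w) = dot u v + dot u w.
Proof. by rewrite dotC dotDl !(dotC u). Qed.

Lemma dotZr a u v : dot u (a *: v) = a * dot u v.
Proof. by rewrite dotC dotZl (dotC u). Qed.

Lemma dotBr u v w : dot u (v - w) = dot u v - dot u w.
Proof. by rewrite dotC dotBl !(dotC u). Qed.

Lemma dot_ge0 u : 0 <= dot u u.
Proof. by apply: sumr_ge0 => i _; rewrite -expr2 sqr_ge0. Qed.

Lemma enorm_ge0 u : 0 <= enorm u.
Proof. exact: sqrtr_ge0. Qed.

Lemma sqr_enorm u : enorm u ^+ 2 = dot u u.
Proof. exact/sqr_sqrtr/dot_ge0. Qed.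

Lemma sqr_enormD u v :
  enorm (u + v) ^+ 2 = enorm u ^+ 2 + 2 * dot u v + enorm v ^+ 2.
Proof. by rewrite !sqr_enorm dotDl !dotDr (dotC v u); ring. Qed.

Lemma enormZ a u : enorm (a *: u) = `|a| * enorm u.
Proof.
by rewrite /enorm dotZl dotZr mulrA -expr2 sqrtrM ?sqr_ge0// sqrtr_sqr.
Qed.

Lemma enorm0 : enorm (0 : 'rV[R]_n) = 0.
Proof. by rewrite -(scale0r 0) enormZ normr0 mul0r. Qed.

Lemma enormBC u v : enorm (u - v) = enorm (v - u).
Proof. by rewrite -opprB -scaleN1r enormZ normrN1 mul1r. Qed.

Lemma enorm_eq0 u : enorm u = 0 -> u = 0.
Proof.
move=> u0; have u2 : dot u u = 0 by rewrite -sqr_enorm u0 expr0n.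
apply/rowP => i; rewrite mxE; apply/eqP; rewrite -sqrf_eq0 expr2; apply/eqP.
by apply: (psumr_eq0P _ u2) => // j _; rewrite -expr2 sqr_ge0.
Qed.

(** For nonzero vectors, expand the square of [enorm v *: u - enorm u *: v]: it is a positive
    multiple of [enorm u * enorm v - dot u v]. *)
Lemma cauchy_schwarz u v : dot u v <= enorm u * enorm v.
Proof.
have [/enorm_eq0 ->|u0] := eqVneq (enorm u) 0.
  by rewrite enorm0 mul0r dot0l.
have [/enorm_eq0 ->|v0] := eqVneq (enorm v) 0.
  by rewrite enorm0 mulr0 dotC dot0l.
have u_gt0 : 0 < enorm u by rewrite lt_def u0 enorm_ge0.
have v_gt0 : 0 < enorm v by rewrite lt_def v0 enorm_ge0.
have := dot_ge0 (enorm v *: u - enorm u *: v).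
rewrite dotBl !dotBr !dotZl !dotZr -!sqr_enorm (dotC v u).
have -> : enorm v * (enorm v * enorm u ^+ 2) - enorm v * (enorm u * dot u v) -
  (enorm u * (enorm v * dot u v) - enorm u * (enorm u * enorm v ^+ 2)) =
  (2 * enorm u * enorm v) * (enorm u * enorm v - dot u v) by ring.
by rewrite pmulr_rge0 ?subr_ge0// !mulr_gt0.
Qed.

Lemma sqr_gnorm G c u : 0 <= c -> sym_ge G c -> Defs.gnorm G u ^+ 2 = dot (u *m G) u.
Proof.
by move=> c0 [_ Gc]; rewrite sqr_sqrtr// (le_trans _ (Gc u))// mulr_ge0 ?dot_ge0.
Qed.

Lemma bounded_enorm (X : set 'rV[R]_n) : bounded_set X ->
  exists M : R, forall x y, X x -> X y -> enorm (x - y) <= M.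
Proof.
(* Boundedness refers to the sup norm and holds with every bound above [M], whence [M + 1]; each
   coordinate of [x - y] is then at most [2 * (M + 1)] in absolute value. *)
move=> [M [_ /(_ (M + 1))]]; rewrite ltrDl ltr01 => /(_ isT) XM.
exists (Num.sqrt (\sum_(i < n) (2 * (M + 1)) ^+ 2)) => x y Xx Xy.
apply: ler_wsqrtr; apply: ler_sum => i _.
have X_le z : X z -> `|z ord0 i| <= M + 1.
  move=> /XM; apply: le_trans; rewrite /Num.norm/= mx_normrE.
  exact: (le_bigmax _ (fun k : 'I_1 * 'I_n => `|z k.1 k.2|) (ord0, i)).
rewrite -expr2 -real_normK ?num_real// lerXn2r ?nnegrE//.
  by rewrite mulr_ge0// (le_trans _ (X_le _ Xx)).
by rewrite !mxE (le_trans (ler_normB _ _))// mulr_natl mulr2n lerD ?X_le.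
Qed.

Lemma convex_setP (X : set 'rV[R]_n) u v t : convex_set X -> X u -> X v ->
  0 <= t <= 1 -> X ((1 - t) *: u + t *: v).
Proof.
move=> cX Xu Xv /andP[t0 t1]; apply/set_mem; rewrite addrC.
by apply: (cX v u (Itv01 t0 t1)); exact: mem_set.
Qed.

Lemma convex_functionP (X : set 'rV[R]_n) (f : 'rV[R]_n -> R) u v t :
  convex_function X f -> X u -> X v -> 0 <= t <= 1 ->
  f ((1 - t) *: u + t *: v) <= (1 - t) * f u + t * f v.
Proof.
move=> cf Xu Xv /andP[t0 t1]; rewrite addrC [leRHS]addrC.
by apply: (cf (Itv01 t0 t1) v u); exact: mem_set.
Qed.

End Geometry.

(** * Hoelder gradients *)

Section GradientSegment.
Context {R : realType} {n : nat}.
Implicit Types (x y : 'rV[R]_n) (s t e : R).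
Variables (X : set 'rV[R]_n) (f : 'rV[R]_n -> R) (df : 'rV[R]_n -> 'rV[R]_n).
Hypothesis cX : convex_set X.

(** Pulls relative differentiability back to a segment. An estimate for [s] near [t] within [0, 1],
    in place of a derivative, covers the endpoints too. *)
Lemma is_gradient_segment x y t e : is_gradient X f df -> X x -> X y ->
  0 <= t <= 1 -> 0 < e -> \forall s \near t, 0 <= s <= 1 ->
  `|f ((1 - s) *: x + s *: y) - f ((1 - t) *: x + t *: y)
    - (s - t) * dot (df ((1 - t) *: x + t *: y)) (y - x)| <= e * `|s - t|.
Proof.
move=> gf Xx Xy t01 e0; pose z r := (1 - r) *: x + r *: y.
have Xz r : 0 <= r <= 1 -> X (z r) by exact: convex_setP.
have dz r : z r - z t = (r - t) *: (y - x).
  by rewrite /z; apply/rowP => i; rewrite !mxE; ring.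
(* The summand 1 keeps the divisor positive when [x = y]. *)
have d0 : 0 < enorm (y - x) + 1 by rewrite ltr_wpDl// enorm_ge0.
have := gf (z t) (Xz t t01) _ (divr_gt0 e0 d0).
have cz : z r @[r --> t] --> z t.
  rewrite /z; apply: cvgD; apply: cvgZr_tmp.
    by apply: cvgB; [exact: cvg_cst|exact: cvg_id].
  exact: cvg_id.
move=> /cz; rewrite !near_simpl/=; apply: filterS => s fs s01.
have := fs (Xz s s01); rewrite dz dotZr enormZ => /le_trans; apply.
rewrite (mulrC `|s - t|) mulrA ler_wpM2r// mulrAC ler_pdivrMr//.
apply: ler_wpM2l; first exact: ltW.
by rewrite lerDl.
Qed.

End GradientSegment.

(** * One-variable calculus on [0, 1] *)

Section Segment.
Context {R : realType}.
Variables (phi dphi : R -> R).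
Hypothesis dphiP : forall t e : R, 0 <= t <= 1 -> 0 < e ->
  \forall s \near t, 0 <= s <= 1 ->
    `|phi s - phi t - (s - t) * dphi t| <= e * `|s - t|.

Lemma segment_is_derive (t : R) : 0 < t < 1 -> is_derive t 1 phi (dphi t).
Proof.
move=> /andP[t0 t1].
have L : (fun h : R => h^-1 *: (phi (h *: 1 + t) - phi t)) @ 0^' --> dphi t.
  apply/cvgrPdist_le => e e0.
  have t01 : 0 <= t <= 1 by rewrite !ltW.
  have c : h *: 1 + t @[h --> (0 : R)] --> t.
    rewrite -[X in _ --> X]add0r -[X in _ --> X + _](scale0r (1 : R)).
    by apply: cvgD; [apply: cvgZr_tmp; exact: cvg_id|exact: cvg_cst].
  have := c _ (dphiP t01 e0); rewrite !near_simpl/= => H.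
  have I01 : \forall h \near (0 : R), 0 <= h *: 1 + t <= 1.
    have : \forall s \near t, 0 <= s <= 1.
      by apply: filterS2 (lt_le_nbhsr t0) (lt_le_nbhsl t1) => s -> ->.
    by move=> /c; rewrite !near_simpl.
  near=> h.
  have h0 : h != 0 by near: h; exact: nbhs_dnbhs_neq.
  have : 0 <= h *: 1 + t <= 1 by near: h; exact: nbhs_dnbhs.
  have : 0 <= h *: 1 + t <= 1 ->
    `|phi (h *: 1 + t) - phi t - (h *: 1 + t - t) * dphi t| <= e * `|h *: 1 + t - t|.
    by near: h; exact: nbhs_dnbhs.
  move=> /[apply]; rewrite addrK [h *: 1]mulr1 => He.
  have -> : dphi t - h^-1 *: (phi (h + t) - phi t) =
      - (h^-1 * (phi (h + t) - phi t - h * dphi t)).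
    by rewrite mulrBr mulKf// opprB.
  by rewrite normrN normrM normfV mulrC ler_pdivrMr ?normr_gt0.
apply: DeriveDef; first exact: (cvgP _ L).
exact: cvg_lim L.
Unshelve. all: by end_near. Qed.

Lemma segment_continuous : {within `[0, 1], continuous phi}.
Proof.
apply/subspace_continuousP => t /=; rewrite in_itv/= => t01.
apply/cvgrPdist_le => e e0; rewrite near_withinE.
(* The expansion with error 1 gives |phi s - phi t| <= (1 + |dphi t|) |s - t|. *)
have d0 : 0 < 1 + `|dphi t| by rewrite ltr_pwDl.
near=> s; rewrite /= in_itv/= => s01.
have : `|s - t| <= e / (1 + `|dphi t|).
  by rewrite distrC; near: s; apply: cvgr_dist_le; rewrite ?divr_gt0.
rewrite ler_pdivlMr// => st.
have : `|phi s - phi t - (s - t) * dphi t| <= 1 * `|s - t|.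
  by move: s01; near: s; exact: dphiP.
rewrite mul1r => H; rewrite distrC.
rewrite -[phi s - _](subrK ((s - t) * dphi t)) (le_trans (ler_normD _ _))//.
by rewrite normrM (le_trans _ st)// mulrDr mulr1 lerD2r.
Unshelve. all: by end_near. Qed.

End Segment.

(** The mean value theorem replaces integration: [psi] is [phi] minus an antiderivative of a + M
    t^nu, so its derivative is nonpositive on the open interval. *)
Lemma mvt_hoelder {R : realType} (phi dphi : R -> R) (a M nu : R) : 0 <= nu ->
  (forall t e : R, 0 <= t <= 1 -> 0 < e -> \forall s \near t, 0 <= s <= 1 ->
    `|phi s - phi t - (s - t) * dphi t| <= e * `|s - t|) ->
  (forall t, 0 <= t <= 1 -> dphi t - a <= M * t `^ nu) ->
  phi 1 - phi 0 - a <= M / (1 + nu).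
Proof.
move=> nu0 dphiP dphi_le.
have nu1 : 0 < 1 + nu by rewrite ltr_pwDl.
pose psi t := phi t - (a * t + M / (1 + nu) * t `^ (1 + nu)).
have dpow (t : R) : 0 < t ->
    is_derive t 1 (fun t : R => t `^ (1 + nu)) ((1 + nu) * t `^ nu).
  by move=> t0; have := is_derive1_powR (1 + nu) t0; rewrite (addrC 1) addrK.
have cpow1 : forall t : R, 0 < t -> {for t, continuous (fun t : R => t `^ (1 + nu))}.
  move=> t t0; apply: differentiable_continuous; apply/derivable1_diffP.
  by have [] := dpow t t0.
(* The power is differentiated at t > 0 only; continuity at 0 is a separate limit. *)
have cpow : {within `[0, 1], continuous (fun t : R => t `^ (1 + nu))}.
  apply/continuous_within_itvP => //; split.
  - move=> t; rewrite in_itv/= => /andP[t0 _]; exact: cpow1.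
  - by rewrite powR0 ?gt_eqF//; exact: powR_cvg0.
  - by apply: cvg_at_left_filter; exact: cpow1.
have [|||c] := @MVT R psi (fun t => dphi t - (a + M * t `^ nu)) 0 1.
- exact: ltr01.
- move=> t; rewrite in_itv/= => t01; have /andP[t0 _] := t01.
  have := dpow t t0; have := segment_is_derive dphiP t01 => d1 d2.
  rewrite /psi; apply: is_derive_eq.
  rewrite /GRing.scale /=; field; lra.
- have cphi : {within `[0, 1], continuous phi} by exact: (segment_continuous dphiP).
  have clin : {within `[0, 1], continuous (fun t : R => a * t)}.
    by apply: continuous_subspaceT => ?; exact: mulrl_continuous.
  have cpow' : {within `[0, 1], continuous (fun t : R => M / (1 + nu) * t `^ (1 + nu))}.
    apply: (@within_continuous_comp R R R _ _ (fun r => M / (1 + nu) * r) _ cpow) => ? _.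
    exact: mulrl_continuous.
  exact: (within_continuousB cphi (within_continuousD clin cpow')).
- rewrite in_itv/= => /andP[c0 c1]; rewrite /psi subr0 mulr1 powR1 powR0 ?gt_eqF// => psiE.
  have c01 : 0 <= c <= 1 by rewrite !ltW.
  by have := dphi_le c c01; lra.
Qed.

Section Descent.
Context {R : realType} {n : nat}.
Implicit Types (x y : 'rV[R]_n).
Variables (X : set 'rV[R]_n) (f : 'rV[R]_n -> R) (df : 'rV[R]_n -> 'rV[R]_n).
Hypothesis cX : convex_set X.

(** For a small step [s] towards [y], compare the first-order expansion at [x] with the chord
    inequality and divide by [s]; the error left is [e]. *)
Lemma is_gradient_subgradient :
  is_gradient X f df -> convex_function X f -> is_subgradient X f df.
Proof.
move=> gf cf x y Xx Xy; apply/ler_addgt0Pr => e e0.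
have e1 : 0 <= (0 : R) <= 1 by rewrite lexx ler01.
have := is_gradient_segment cX gf Xx Xy e1 e0.
rewrite subr0 scale1r scale0r addr0 => fx.
have : \forall s \near (0 : R)^'+, [/\ 0 < s, s < 1 & `|f ((1 - s) *: x + s *: y) - f x
    - (s - 0) * dot (df x) (y - x)| <= e * `|s - 0|].
  near=> s; have s0 : 0 < s by near: s; exact: nbhs_right_gt.
  have s1 : s < 1 by near: s; exact: nbhs_right_lt.
  split=> //; have : 0 <= s <= 1 by rewrite !ltW.
  by near: s; apply: cvg_within; exact: fx.
move=> /filter_ex[s [s0 s1]]; rewrite subr0 (gtr0_norm s0) ler_norml => /andP[+ _].
have s01 : 0 <= s <= 1 by rewrite !ltW.
have := convex_functionP cf Xx Xy s01 => h1 h2.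
have : s * (f x + dot (df x) (y - x)) <= s * (f y + e) by lra.
by rewrite ler_pM2l.
Unshelve. all: by end_near. Qed.

Variables (nu H : R).
Hypothesis nu_ge0 : 0 <= nu.
Hypothesis hoelder_df : forall x y, X x -> X y ->
  enorm (df y - df x) <= H * enorm (y - x) `^ nu.

Lemma hoelder_dot x y t : X x -> X y -> 0 <= t <= 1 ->
  dot (df ((1 - t) *: x + t *: y)) (y - x) - dot (df x) (y - x) <=
    H * enorm (y - x) `^ (1 + nu) * t `^ nu.
Proof.
move=> Xx Xy t01; have /andP[t0 _] := t01.
rewrite -dotBl (le_trans (cauchy_schwarz _ _))//.
have := hoelder_df Xx (convex_setP cX Xx Xy t01).
have -> : (1 - t) *: x + t *: y - x = t *: (y - x).
  by apply/rowP => i; rewrite !mxE; ring.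
rewrite enormZ ger0_norm// powRM ?enorm_ge0// => /(ler_wpM2r (enorm_ge0 (y - x))).
move=> /le_trans; apply; rewrite powRD; last first.
  by rewrite gt_eqF ?implyFb// ltr_pwDl.
by rewrite powRr1 ?enorm_ge0// le_eqVlt; apply/orP; left; apply/eqP; ring.
Qed.

Lemma hoelder_descent x y : is_gradient X f df -> X x -> X y ->
  f y - f x - dot (df x) (y - x) <= H / (1 + nu) * enorm (y - x) `^ (1 + nu).
Proof.
move=> gf Xx Xy.
pose z t := (1 - t) *: x + t *: y.
have := @mvt_hoelder _ (fun t => f (z t)) (fun t => dot (df (z t)) (y - x))
  (dot (df x) (y - x)) (H * enorm (y - x) `^ (1 + nu)) nu nu_ge0.
rewrite /z subrr !scale0r add0r scale1r subr0 scale1r addr0 [X in _ <= X]mulrAC; apply.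
  move=> t e t01 e0; exact: (is_gradient_segment cX gf Xx Xy t01 e0).
by move=> t t01; exact: hoelder_dot.
Qed.

(** The subgradient inequality at [y] bounds f y - f x by the slope at [y], which is compared with
    the slope at [x]. The factor 1/(1 + nu) is absent, but equals 1 for nu = 0, the case in which
    subgradients are allowed. *)
Lemma subgradient_descent x y : is_subgradient X f df -> X x -> X y ->
  f y - f x - dot (df x) (y - x) <= H * enorm (y - x) `^ (1 + nu).
Proof.
move=> sf Xx Xy; have := sf y x Xy Xx.
have := @hoelder_dot x y 1 Xx Xy; rewrite ler01 lexx => /(_ isT).
rewrite subrr scale0r scale1r add0r powR1 mulr1.
by rewrite -(opprB y x) -[- (y - x)]scaleN1r dotZr; lra.
Qed.

End Descent.

Lemma composite_descent (R : realType) n (X : set 'rV[R]_n) f df chi nu H x y :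
  composite_problem X f df chi nu H -> X x -> X y ->
  f y - f x - dot (df x) (y - x) <= H / (1 + nu) * enorm (y - x) `^ (1 + nu).
Proof.
case=> _ cX _ _ /andP[nu0 _] [gf|[nuE _ sf]] hdf Xx Xy.
  exact: (hoelder_descent cX nu0 hdf).
have := subgradient_descent cX nu0 hdf sf Xx Xy.
by rewrite nuE addr0 divr1.
Qed.

Lemma composite_subgradient (R : realType) n (X : set 'rV[R]_n) f df chi nu H :
  composite_problem X f df chi nu H -> convex_function X f ->
  is_subgradient X f df.
Proof.
by case=> _ cX _ _ _ [gf|[]]// _ cf; exact: is_gradient_subgradient.
Qed.

(** * The gradient step *)

Section HoelderConstant.
Context {R : realType}.
Implicit Types (nu H y p : R).

(** Homogeneity in [H]: it isolates a factor depending on [nu] only, so that the final constant does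
    not involve [H]. *)
Lemma LconstE nu H : 0 <= H -> Lconst nu H = Lconst nu 1 * H `^ (2 / (1 + nu)).
Proof.
move=> H0; rewrite /Lconst; case: eqP => [->|_].
  have -> : 2 / (1 + 1) = 1 :> R by rewrite divff.
  by rewrite powRr1// mul1r mulrC.
by rewrite -powRM//; [rewrite mul1r mulrC|rewrite div1r invr_ge0 mulr_ge0// powR_ge0].
Qed.

Lemma Lconst_gt0 nu H : 0 <= nu <= 1 -> 0 < H -> 0 < Lconst nu H.
Proof.
move=> /andP[nu0 nu1] H0.
rewrite /Lconst; case: eqP => [_|/eqP nuN1]; first by rewrite divr_gt0.
have nu1' : 0 < 1 - nu by rewrite subr_gt0 lt_neqAle nuN1.
by rewrite powR_gt0// divr_gt0// mulr_gt0// powR_gt0// divr_gt0// ltr_pwDl.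
Qed.

Lemma le_add1_powR y p : 0 <= y -> 1 <= p -> y <= 1 + y `^ p.
Proof.
move=> y0 p1; have [y1|y1] := leP y 1.
  by rewrite (le_trans y1)// lerDl powR_ge0.
by rewrite (le_trans (le1r_powR (ltW y1) p1))// lerDr.
Qed.

End HoelderConstant.

Section GradientStep.
Context {R : realType} {n : nat}.
Variables (X : set 'rV[R]_n) (f : 'rV[R]_n -> R) (df : 'rV[R]_n -> 'rV[R]_n).
Variables (chi : 'rV[R]_n -> R) (nu H sigma gamma gamma2 : R).
Hypothesis pb : composite_problem X f df chi nu H.
Hypothesis sigma_ge0 : 0 <= sigma.

(** Compare [u] with points of the segment from [u] to [z] close to [u]. Comparing with [z] itself
    would give only half of the decrease. *)
Lemma prox_decrease z (G : 'M[R]_n) beta u :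
  sym_ge G sigma -> 0 < beta -> X z -> is_argmin X (prox_obj df chi z G beta) u ->
  dot (df z) (u - z) + chi u - chi z <= - (sigma / beta * enorm (u - z) ^+ 2).
Proof.
move=> hG beta0 Xz [Xu umin].
have [_ cX cchi _ _ _ _] := pb.
set Q := dot ((u - z) *m G) (u - z).
have QG : sigma * enorm (u - z) ^+ 2 <= Q by rewrite sqr_enorm; apply hG.
have Q0 : 0 <= Q by rewrite (le_trans _ QG)// mulr_ge0// exprn_ge0// enorm_ge0.
suff : dot (df z) (u - z) + chi u - chi z <= - (Q / beta).
  move=> /le_trans; apply; rewrite lerN2 mulrAC ler_pM2r// invr_gt0//.
apply/ler_addgt0Pr => e e0.
have D0 : 0 < 1 + Q / (2 * beta).
  by rewrite ltr_pwDl// divr_ge0// mulr_ge0// ltW.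
(* After division by [s] the excess is [s] times Q/(2 beta), which this choice keeps below [e]. *)
pose s := Num.min 2^-1 (e / (1 + Q / (2 * beta))).
have s0 : 0 < s by rewrite lt_min invr_gt0 ltr0n/= divr_gt0.
have s12 : s <= 2^-1 by rewrite ge_min lexx.
have se : s * (1 + Q / (2 * beta)) <= e.
  by rewrite -ler_pdivlMr// ge_min lexx orbT.
have s01 : 0 <= s <= 1 by rewrite ltW//= (le_trans s12)// invf_le1// ler1n.
have := umin _ (convex_setP cX Xu Xz s01).
have cs := convex_functionP cchi Xu Xz s01.
rewrite /prox_obj (dotDr (df z) ((1 - s) *: u)) !dotZr dotBr.
have -> : (1 - s) *: u + s *: z - z = (1 - s) *: (u - z).
  by apply/rowP => i; rewrite !mxE; ring.
rewrite !(sqr_gnorm _ sigma_ge0 hG) -scalemxAl dotZl dotZr -/Q => h.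
have bE : Q / beta = 2 * (Q / (2 * beta)) by field; rewrite gt_eqF.
rewrite bE; set q := Q / (2 * beta) in bE h se D0 *.
have E : ((1 - s) * ((1 - s) * Q)) / (2 * beta) = (1 - s) ^+ 2 * q.
  by rewrite /q; ring.
rewrite E in h.
have q0 : 0 <= q by rewrite divr_ge0// mulr_ge0// ltW.
rewrite -(ler_pM2l s0).
have : s * s * q <= s * e.
  by rewrite -mulrA ler_pM2l//; lra.
nra.
Qed.

Lemma gs_beta_gt0 k z g : 0 < gamma2 ->
  gradient_step X f df chi sigma gamma gamma2 k z g -> 0 < gs_beta gamma2 g.
Proof. by move=> g20 [hb _ _ _ _]; rewrite mulr_gt0// exprn_gt0. Qed.

(* Multiply [y <= 1 + y `^ p] at [y = k H d `^ (1 + nu)], [p = 2 / (1 + nu)]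
   by [1 / k]. *)
Lemma hoelder_quadratic (k : nat) (d : R) : (0 < k)%N -> 0 <= d ->
  H / (1 + nu) * d `^ (1 + nu) <=
    k%:R `^ ((1 - nu) / (1 + nu)) * H `^ (2 / (1 + nu)) * d ^+ 2 + k%:R^-1.
Proof.
move=> k0 d0; have [_ _ _ H0 /andP[nu0 nu1] _ _] := pb.
have n0 : 0 < 1 + nu by rewrite ltr_pwDl.
have kR0 : 0 < k%:R :> R by rewrite ltr0n.
have p1 : 1 <= 2 / (1 + nu) by rewrite ler_pdivlMr// mul1r; lra.
have y0 : 0 <= k%:R * H * d `^ (1 + nu) by rewrite !mulr_ge0 ?powR_ge0// ltW.
have := le_add1_powR y0 p1.
rewrite powRM ?powR_ge0 ?mulr_ge0// ?(ltW kR0) ?(ltW H0)// powRM ?(ltW kR0) ?(ltW H0)//.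
rewrite -powRrM mulrCA divff ?gt_eqF// mulr1 powR_mulrn//.
have -> : k%:R `^ (2 / (1 + nu)) = k%:R * k%:R `^ ((1 - nu) / (1 + nu)).
  have -> : 2 / (1 + nu) = 1 + (1 - nu) / (1 + nu) by field; rewrite gt_eqF.
  by rewrite powRD ?powRr1 ?ltW// (gt_eqF kR0) implybT.
move=> h; apply: (@le_trans _ _ (H * d `^ (1 + nu))).
  by rewrite ler_wpM2r ?powR_ge0// ler_pdivrMr// ler_peMr ?(ltW H0)// lerDl.
rewrite -(ler_pM2l kR0) mulrDr divff ?gt_eqF//; lra.
Qed.

(** The proximal decrease exceeds the decrease demanded by the test by (2 sigma - gamma)/(2 beta)
    times the squared step. This surplus absorbs the quadratic part of the Hoelder error, and the
    tolerance 1/k absorbs the rest. *)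
Lemma ls_acceptW (k : nat) z (G : 'M[R]_n) beta u : (0 < k)%N -> sym_ge G sigma ->
  0 < beta -> X z -> is_argmin X (prox_obj df chi z G beta) u ->
  k%:R `^ ((1 - nu) / (1 + nu)) * H `^ (2 / (1 + nu)) <=
    (2 * sigma - gamma) / (2 * beta) ->
  ls_accept f chi gamma k z beta u.
Proof.
move=> k0 hG beta0 Xz ua hb; have [Xu _] := ua.
have h1 := prox_decrease hG beta0 Xz ua.
have h2 := composite_descent pb Xz Xu.
have h3 := hoelder_quadratic k0 (enorm_ge0 (u - z)).
have h4 : k%:R `^ ((1 - nu) / (1 + nu)) * H `^ (2 / (1 + nu)) * enorm (u - z) ^+ 2
    <= (2 * sigma - gamma) / (2 * beta) * enorm (u - z) ^+ 2.
  by rewrite ler_wpM2r// exprn_ge0// enorm_ge0.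
rewrite /ls_accept /Psi.
have E : (2 * sigma - gamma) / (2 * beta) * enorm (u - z) ^+ 2 =
  sigma / beta * enorm (u - z) ^+ 2 - gamma / (2 * beta) * enorm (u - z) ^+ 2.
  by field; rewrite gt_eqF.
rewrite {}E in h4; lra.
Qed.

(** Either the first trial is accepted and the assumption on the initial stepsize applies, or the
    trial before the accepted one, larger by 1/gamma2, failed the test and so violates the
    sufficient condition for acceptance. In the denominator, [Lconst nu 1] serves the first case and
    2 the second. *)
Lemma stepsize_ge (k : nat) z g : (0 < k)%N -> X z -> 0 < gamma2 <= 1 ->
  0 <= 2 * sigma - gamma ->
  gradient_step X f df chi sigma gamma gamma2 k z g ->
  (2 * sigma - gamma) / Lconst nu H <= gs_hbeta g ->
  gamma2 * (2 * sigma - gamma) / (2 + Lconst nu 1) <=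
    gs_beta gamma2 g * (k%:R `^ ((1 - nu) / (1 + nu)) * H `^ (2 / (1 + nu))).
Proof.
move=> k0 Xz /andP[g20 g21] sg0 gs hb.
have beta0 := gs_beta_gt0 g20 gs.
have [_ _ _ H0 /andP[nu0 nu1] _ _] := pb.
have nu01 : 0 <= nu <= 1 by rewrite nu0.
have c0 := ltW (Lconst_gt0 nu01 ltr01).
set M := k%:R `^ _ * _.
have M0 : 0 < M by rewrite mulr_gt0 ?powR_gt0// ltr0n.
have HM : H `^ (2 / (1 + nu)) <= M.
  rewrite ler_peMl ?powR_ge0// -[leLHS](powRr0 k%:R).
  by rewrite ler_powR ?ler1n// divr_ge0//; lra.
have D0 : 0 < 2 + Lconst nu 1 by rewrite ltr_pwDl.
rewrite ler_pdivrMr// -mulrA.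
case: gs => hb0 hG ua acc rej.
case E : (gs_tau g) => [|tau].
  have -> : gs_beta gamma2 g = gs_hbeta g by rewrite /gs_beta E expr0 mulr1.
  apply: (@le_trans _ _ (2 * sigma - gamma)); first by rewrite ler_piMl.
  move: hb; rewrite ler_pdivrMr ?Lconst_gt0// => /le_trans; apply.
  rewrite ler_pM2l// LconstE ?(ltW H0)// mulrDr mulrC ler_wpDl ?ler_wpM2r//.
  by rewrite mulr_ge0// ltW.
have [|u ua' nacc] := rej tau; first by rewrite E.
set b := gs_hbeta g * gamma2 ^+ tau in ua' nacc.
have b0 : 0 < b by rewrite mulr_gt0// exprn_gt0.
have -> : gs_beta gamma2 g = gamma2 * b by rewrite /gs_beta E exprS /b; ring.
clearbody b; rewrite -!mulrA ler_pM2l// mulrA.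
have [hM|] := leP M ((2 * sigma - gamma) / (2 * b)).
  by exfalso; apply: nacc; exact: ls_acceptW hG b0 Xz ua' hM.
rewrite ltr_pdivrMr ?mulr_gt0// => /ltW /le_trans; apply.
by have := mulr_ge0 (mulr_ge0 (ltW b0) (ltW M0)) c0; rewrite /M; lra.
Qed.

End GradientStep.

(** * Descent along a run *)

Section Run.
Context {R : realType} {n : nat}.
Variables (X : set 'rV[R]_n) (f : 'rV[R]_n -> R) (df : 'rV[R]_n -> 'rV[R]_n).
Variables (chi : 'rV[R]_n -> R) (sigma gamma gamma2 eta : R) (alpha : nat -> R).
Hypothesis cX : convex_set X.
Hypothesis alpha01 : forall t, (0 < t)%N -> 0 <= alpha t <= 1.
Implicit Types (s : @state R n) (g : @gstep R n).

Let iter := iteration X f df chi sigma gamma gamma2 eta alpha.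

Definition in_domain s :=
  [/\ X (xag s), X (xhat s), X (xcur s), X (xorig s) & loc s `<=` X].

Lemma start_phase_in_domain i xa p lo s :
  X xa -> X p -> start_phase X f chi eta i xa p lo s -> in_domain s.
Proof.
by move=> Xxa Xp [[_ _ xaE xhE] _ Xo xcE [_ _ _ locX]]; split; rewrite ?xaE ?xhE ?xcE.
Qed.

(* x^md of the iteration that starts in the state s *)
Definition md_point s := (1 - alpha (inner s).+1) *: xhat s + alpha (inner s).+1 *: xcur s.

Lemma md_point_in s : in_domain s -> X (md_point s).
Proof. by case=> _ Xh Xc _ _; exact: convex_setP Xh Xc (alpha01 _). Qed.

Lemma iteration_in_domain k g s s' : in_domain s -> iter k g s s' -> in_domain s'.
Proof.
case=> Xa Xh Xc Xo locX [lbt [xt [xh [_ [sub1 sub0] gs [xhE _] stop]]]].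
have Xt : X xt.
  have [sub_0|/set0P/sub1[[/locX]]//] := eqVneq
    [set x | loc s x /\ hlin f df chi (md_point s) x <= level eta s] set0.
  by rewrite sub0.
have Xxh : X xh.
  case: gs => _ _ [Xb _] _ _.
  by case: xhE => ->//; exact: convex_setP Xh Xt (alpha01 _).
case: stop => [[_ sp]|[_ [[_ _ xaE xhE'] xoE xcE _ [_ _ _ locE]]]].
  exact: start_phase_in_domain sp.
by split; rewrite ?xaE ?xhE' ?xoE ?xcE// => x /locE[].
Qed.

Lemma iteration_decrease k g s s' : iter k g s s' ->
  [/\ gradient_step X f df chi sigma gamma gamma2 k (xag s) g,
      xag s' = xhat s', Psi f chi (xhat s') <= Psi f chi (xhat s)
    & Psi f chi (xhat s') <= Psi f chi (gs_xbar g)].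
Proof.
move=> [lbt [xt [xh [_ _ gs [_ PE] stop]]]].
have [E1 E2] : xag s' = xh /\ xhat s' = xh.
  by case: stop => [[_ [[]]]|[_ [[]]]].
by split=> //; rewrite ?E1 ?E2// PE !ge_min lexx ?orbT.
Qed.

End Run.

Section RunDescent.
Context {R : realType} {n : nat}.
Variables (X : set 'rV[R]_n) (f : 'rV[R]_n -> R) (df : 'rV[R]_n -> 'rV[R]_n).
Variables (chi : 'rV[R]_n -> R) (nu H sigma gamma gamma2 eta : R) (alpha : nat -> R).
Variables (p0 : 'rV[R]_n) (st : nat -> @state R n) (g : nat -> @gstep R n).
Hypothesis pb : composite_problem X f df chi nu H.
Hypothesis run : uapl_run X f df chi sigma gamma gamma2 eta alpha p0 st g.
Hypothesis gamma2_gt0 : 0 < gamma2.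

Lemma run_alpha t : (0 < t)%N -> 0 <= alpha t <= 1.
Proof.
have [_ [a1 a2] _ _ _] := run; case: t => [//|[_|t _]].
  by rewrite a1 ler01 lexx.
by have /andP[/ltW -> /ltW ->] := a2 t.+2 isT.
Qed.

Lemma run_in_domain k : in_domain X (st k).
Proof.
have [_ cX _ _ _ _ _] := pb; have [Xp0 _ _ [p1 [Xp1 _] sp] it] := run.
elim: k => [|k IH]; first exact: start_phase_in_domain sp.
by apply: iteration_in_domain (it k) => //; exact: run_alpha.
Qed.

Lemma run_gradient_step k : (0 < k)%N ->
  gradient_step X f df chi sigma gamma gamma2 k (xag (st k.-1)) (g k).
Proof.
by case: k => // k _; have [_ _ _ _ /(_ k)/iteration_decrease[]] := run.
Qed.

Lemma run_descent k :
  Psi f chi (xag (st k.+1)) <= Psi f chi (xag (st k))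
    - gamma / 2 * (gs_beta gamma2 (g k.+1) * enorm (proj_grad gamma2 st g k.+1) ^+ 2)
    + k.+1%:R^-1.
Proof.
have [_ _ _ _ /(_ k)/iteration_decrease[gs -> _ le]] := run.
apply: (le_trans le); case: (gs) => _ _ _ acc _; apply: (le_trans acc).
have b0 := gs_beta_gt0 gamma2_gt0 gs.
rewrite lerD2r lerD2l lerN2 /proj_grad enormZ exprMn real_normK ?num_real// enormBC /=.
by rewrite le_eqVlt; apply/orP; left; apply/eqP; field; rewrite gt_eqF.
Qed.

(** The summand 1 is the error 1/k of the first gradient step, which starts from [p0] while [xhat]
    is [p1]. Afterwards [xag] and [xhat] agree and the values do not increase. *)
Lemma run_Psi_xag k : 0 <= gamma -> Psi f chi (xag (st k)) <= Psi f chi p0 + 1.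
Proof.
move=> gamma0; have [_ _ _ [p1 _ sp] it] := run.
have xag0 : xag (st 0%N) = p0 by case: sp => [[]].
elim: k => [|[|k] IH]; first by rewrite xag0 lerDl.
  apply: (le_trans (run_descent 0)); rewrite xag0 invr1 lerD2r gerDl oppr_le0.
  have b0 := gs_beta_gt0 gamma2_gt0 (run_gradient_step (ltn0Sn 0)).
  apply: mulr_ge0; first by rewrite divr_ge0.
  by rewrite mulr_ge0 ?(ltW b0)// exprn_ge0 ?enorm_ge0.
have /iteration_decrease[_ -> le _] := it k.+1; apply: (le_trans le).
by have /iteration_decrease[_ <- _ _] := it k.
Qed.

End RunDescent.

(** * Complexity of the projected gradient *)

Section Complexity.
Context {R : realType} {n : nat}.
Variables (X : set 'rV[R]_n) (f : 'rV[R]_n -> R) (df : 'rV[R]_n -> 'rV[R]_n).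
Variables (chi : 'rV[R]_n -> R) (nu H sigma gamma gamma2 eta : R) (alpha : nat -> R).
Variables (p0 : 'rV[R]_n) (st : nat -> @state R n) (g : nat -> @gstep R n).
Hypothesis pb : composite_problem X f df chi nu H.
Hypothesis run : uapl_run X f df chi sigma gamma gamma2 eta alpha p0 st g.
Hypothesis gamma2_gt0 : 0 < gamma2.
Hypothesis gamma_gt0 : 0 < gamma.
Hypothesis Psi_lb : has_lbound [set Psi f chi x | x in X].
Variables (b eps : R).
Hypothesis b_gt0 : 0 < b.
Hypothesis eps_gt0 : 0 < eps.
Hypothesis step_ge : forall k, (0 < k)%N -> b <= gs_beta gamma2 (g k) *
  (k%:R `^ ((1 - nu) / (1 + nu)) * H `^ (2 / (1 + nu))).

(** With m = K./2, the last K - m steps are few enough for errors of at most 1/(m + 1) to add up to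
    at most 1, and make up at least half of all steps. *)
Lemma half_split K :
  [/\ K./2 <= K, K - K./2 <= K./2.+1 & K <= (K - K./2) * 2]%N.
Proof. by have := odd_double_half K; case: (odd K) => /= h; split; lia. Qed.

Lemma proj_grad_horizon K : (0 < K)%N ->
  (forall k, (0 < k <= K)%N -> eps < enorm (proj_grad gamma2 st g k) ^+ 2) ->
  K%:R `^ (2 * nu / (1 + nu)) <=
    8 / (gamma * b) * H `^ (2 / (1 + nu)) * ((Psi f chi p0 - Psi_opt X f chi + 1) / eps).
Proof.
move=> K0 big; have [_ _ _ H0 /andP[nu0 nu1] _ _] := pb.
have n0 : 0 < 1 + nu by rewrite ltr_pwDl.
have KR0 : 0 < K%:R :> R by rewrite ltr0n.
set Delta := Psi f chi p0 - Psi_opt X f chi.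
set a := (1 - nu) / (1 + nu); set P := H `^ (2 / (1 + nu)).
have a0 : 0 <= a by rewrite divr_ge0 ?subr_ge0// ltW.
have P0 : 0 < P by rewrite powR_gt0.
have opt x : X x -> Psi_opt X f chi <= Psi f chi x.
  by move=> Xx; apply: ge_inf => //; exists x.
have Delta0 : 0 <= Delta by rewrite subr_ge0 opt//; case: run.
(* [d] is a decrease guaranteed at every step up to [K], obtained by replacing k^a by the larger
   K^a. *)
pose m := K./2; pose d := gamma / 2 * (b / (K%:R `^ a * P) * eps).
have Ka0 : 0 < K%:R `^ a * P by rewrite mulr_gt0 ?powR_gt0.
have step k : (m <= k < K)%N -> Psi f chi (xag (st k.+1)) <=
    Psi f chi (xag (st k)) - d + m.+1%:R^-1.
  move=> /andP[mk kK]; apply: (le_trans (run_descent run gamma2_gt0 k)).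
  apply: lerD; last by rewrite lef_pV2 ?posrE ?ltr0n// ler_nat.
  rewrite lerD2l lerN2 ler_wpM2l ?divr_ge0 ?(ltW gamma_gt0)//.
  apply: ler_pM; rewrite ?divr_ge0 ?(ltW b_gt0) ?(ltW eps_gt0) ?(ltW Ka0)//.
    rewrite ler_pdivrMr//; apply: (le_trans (step_ge (ltn0Sn k))).
    have b0 := gs_beta_gt0 gamma2_gt0 (run_gradient_step run (ltn0Sn k)).
    rewrite ler_pM2l// ler_pM2r// ge0_ler_powR// ?nnegrE// ler_nat//.
  by apply/ltW/big.
have sum j : (m + j <= K)%N -> Psi f chi (xag (st (m + j))) <=
    Psi f chi (xag (st m)) - j%:R * d + j%:R * m.+1%:R^-1.
  elim: j => [|j IH] mj; first by rewrite addn0 !mul0r subr0 addr0.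
  rewrite addnS; apply: (le_trans (step _ _)); first by rewrite leq_addr -addnS.
  have := IH (leq_trans (leq_add (leqnn m) (leqnSn j)) mj).
  by rewrite -natr1; lra.
have [mK mj jm'] := half_split K.
have := sum (K - m)%N; rewrite subnKC// leqnn => /(_ isT) sumK.
have XK := opt _ (let: And5 h _ _ _ _ := run_in_domain pb run K in h).
have jm : (K - m)%:R * m.+1%:R^-1 <= 1 :> R.
  by rewrite ler_pdivrMr ?ltr0n// mul1r ler_nat.
have jK : K%:R <= 2 * (K - m)%:R :> R.
  by rewrite mulr_natl -mulrnA ler_nat.
have Pm := run_Psi_xag run gamma2_gt0 m (ltW gamma_gt0).
have d0 : 0 <= d by rewrite !mulr_ge0 ?invr_ge0// ltW// ?mulr_gt0.
have Kd : K%:R * d <= 4 * (Delta + 1).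
  have : K%:R * d <= 2 * (K - m)%:R * d by rewrite ler_wpM2r.
  (* Of the 2, one unit comes from the bound on Psi at step [m] relative to [p0], the other from the
     accumulated errors. *)
  have aux (o x y p r q : R) : o <= x -> x <= y - r + q -> y <= p + 1 -> q <= 1 ->
      r <= p - o + 2 by lra.
  have : (K - m)%:R * d <= Delta + 2 by exact: aux XK sumK Pm jm.
  by rewrite -mulrA; lra.
(* The factor K^a cancels against the one in the denominator of [d]. *)
have KE : K%:R = K%:R `^ (2 * nu / (1 + nu)) * K%:R `^ a.
  rewrite -powRD ?(gt_eqF KR0) ?implybT//.
  have -> : 2 * nu / (1 + nu) + a = 1 by rewrite /a; field; rewrite gt_eqF.
  by rewrite powRr1 ?ltW.
move: Kd; rewrite /d {1}KE.
set x := K%:R `^ (2 * _ / _); set y := K%:R `^ a.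
have y0 : 0 < y by rewrite powR_gt0.
have -> : x * y * (gamma / 2 * (b / (y * P) * eps)) = x * (gamma * b * eps / (2 * P)).
  by field; rewrite !gt_eqF.
rewrite -ler_pdivlMr; last by rewrite divr_gt0 ?mulr_gt0.
move=> /le_trans; apply; rewrite le_eqVlt; apply/orP; left; apply/eqP.
by field; rewrite !gt_eqF.
Qed.

End Complexity.

Lemma proj_grad_complexity (R : realType) (nu sigma gamma gamma2 : R) :
  0 < nu <= 1 -> 0 < gamma -> gamma < sigma -> 0 < gamma2 <= 1 ->
  exists2 C : R, 0 < C &
   forall (n : nat) (X : set 'rV[R]_n) (f : 'rV[R]_n -> R)
     (df : 'rV[R]_n -> 'rV[R]_n) (chi : 'rV[R]_n -> R) (H eta : R)
     (alpha : nat -> R) (p0 : 'rV[R]_n) (st : nat -> state)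
     (g : nat -> gstep) (eps : R),
     composite_problem X f df chi nu H ->
     has_lbound [set Psi f chi x | x in X] ->
     uapl_run X f df chi sigma gamma gamma2 eta alpha p0 st g ->
     (forall k, (1 <= k)%N ->
        (2 * sigma - gamma) / Lconst nu H <= gs_hbeta (g k)) ->
     0 < eps ->
     exists k : nat,
       [/\ (1 <= k)%N,
           k%:Z <= Num.ceil (C * H `^ nu^-1 *
             ((Psi f chi p0 - Psi_opt X f chi + 1) / eps)
               `^ ((1 + nu) / (2 * nu)))
         & enorm (proj_grad gamma2 st g k) ^+ 2 <= eps].
Proof.
move=> /andP[nu0 nu1] gamma0 gs g2; have g20 : 0 < gamma2 by case/andP: g2.
have sg : 0 < 2 * sigma - gamma by lra.
have nu01 : 0 <= nu <= 1 by rewrite ltW.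
have L0 := Lconst_gt0 nu01 ltr01.
set b := gamma2 * (2 * sigma - gamma) / (2 + Lconst nu 1).
have b0 : 0 < b by rewrite divr_gt0 ?mulr_gt0// addr_gt0.
set A := 8 / (gamma * b); have A0 : 0 < A by rewrite divr_gt0// mulr_gt0.
(* The factor 2 makes the contradiction strict: were all gradients large up to K = ceil B, the
   horizon bound would give K <= B/2, whereas 0 < B <= K. *)
exists (2 * A `^ ((1 + nu) / (2 * nu))); first by rewrite mulr_gt0// powR_gt0.
move=> n X f df chi H eta alpha p0 st g eps pb lbX run hb eps0.
have [_ _ _ H0 _ _ _] := pb; have [Xp0 _ _ _ _] := run.
set D := (Psi f chi p0 - Psi_opt X f chi + 1) / eps.
have D0 : 0 < D.
  rewrite divr_gt0// ltr_wpDl// subr_ge0.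
  by apply: ge_inf => //; exists p0.
set B := 2 * _ * _ * _.
have B0 : 0 < B by rewrite !mulr_gt0 ?powR_gt0.
have cB : 0 < Num.ceil B by rewrite ceil_gt0.
have KE : (`|Num.ceil B|%N)%:Z = Num.ceil B by rewrite gez0_abs// ltW.
set K := `|Num.ceil B|%N in KE.
have K0 : (0 < K)%N by rewrite -ltz_nat KE.
apply: contrapT => none.
have big k : (0 < k <= K)%N -> eps < enorm (proj_grad gamma2 st g k) ^+ 2.
  move=> /andP[k0 kK]; rewrite ltNge; apply/negP => ek; apply: none.
  by exists k; split=> //; rewrite -KE lez_nat.
have step k : (0 < k)%N -> b <= gs_beta gamma2 (g k) *
    (k%:R `^ ((1 - nu) / (1 + nu)) * H `^ (2 / (1 + nu))).
  move=> k0; have [Xa _ _ _ _] := run_in_domain pb run k.-1.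
  have s0 : 0 <= sigma by lra.
  exact: (stepsize_ge pb s0 k0 Xa g2 (ltW sg) (run_gradient_step run k0) (hb k k0)).
have := proj_grad_horizon pb run g20 gamma0 lbX b0 eps0 step K0 big.
rewrite -/A -/D => hK; clearbody A D.
have n2 : 0 < 2 * nu by rewrite mulr_gt0.
have n1 : 0 < 1 + nu by rewrite addr_gt0.
have r0 : 0 <= (1 + nu) / (2 * nu) by rewrite divr_ge0 ?ltW.
have := ge0_ler_powR r0 _ _ hK; rewrite !nnegrE powR_ge0.
rewrite !mulr_ge0 ?powR_ge0 ?(ltW A0) ?(ltW D0)// => /(_ isT isT).
rewrite -powRrM.
have -> : 2 * nu / (1 + nu) * ((1 + nu) / (2 * nu)) = 1 by field; rewrite !gt_eqF.
rewrite powRr1// !powRM ?mulr_ge0 ?powR_ge0 ?(ltW A0) ?(ltW D0)// -powRrM.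
have -> : 2 / (1 + nu) * ((1 + nu) / (2 * nu)) = nu^-1 by field; rewrite !gt_eqF.
move=> KB; have : B <= K%:R.
  by rewrite (le_trans (ceil_ge B))// -KE.
have : B = 2 * (A `^ ((1 + nu) / (2 * nu)) * H `^ nu^-1 * D `^ ((1 + nu) / (2 * nu))).
  by rewrite /B; ring.
lra.
Qed.

(** * Phases *)

(** Hoelder's inequality for two terms with exponents 1/a and 1/b. The case a = 0, which arises for
    nu = 1, is an identity treated apart. *)
Lemma hoelder_pair (R : realType) (x y u v a b : R) :
  0 <= x -> 0 <= y -> 0 <= u -> 0 <= v -> 0 <= a -> 0 < b -> a + b = 1 ->
  x `^ a * u `^ b + y `^ a * v `^ b <= (x + y) `^ a * (u + v) `^ b.
Proof.
move=> x0 y0 u0 v0; rewrite le_eqVlt => /predU1P[<- b0|a0 b0 ab].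
  by rewrite add0r !powRr0 !mul1r => ->; rewrite !powRr1// addr_ge0.
have := @hoelder2 R (x `^ a) (y `^ a) (u `^ b) (v `^ b) a^-1 b^-1.
rewrite -!powRrM !invrK !divff ?gt_eqF// !powRr1//; by apply; rewrite ?powR_ge0 ?invr_gt0.
Qed.

Section Phases.
Context {R : realType} {n : nat}.
Variables (X : set 'rV[R]_n) (f : 'rV[R]_n -> R) (df : 'rV[R]_n -> 'rV[R]_n).
Variables (chi : 'rV[R]_n -> R) (nu H sigma gamma gamma2 eta : R) (alpha : nat -> R).
Variables (xstar : 'rV[R]_n).
Hypothesis pb : composite_problem X f df chi nu H.
Hypothesis bX : bounded_set X.
Hypothesis cf : convex_function X f.
Hypothesis minx : is_argmin X (Psi f chi) xstar.
Hypothesis eta01 : 0 < eta < 1.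
Hypothesis alpha01 : forall t, (0 < t)%N -> 0 <= alpha t <= 1.
Implicit Types (s : @state R n).

Let Psif := Psi f chi.
Let h := hlin f df chi.
Let q := qfactor eta.
Let iter := iteration X f df chi sigma gamma gamma2 eta alpha.

(** [1 - eta / 2 <= q] keeps Psi away from the level in an unfinished phase; [eta <= q] makes an
    infeasible subproblem end the phase. *)
Lemma qfactor_bounds : [/\ 0 < q, q < 1, 1 - eta / 2 <= q & eta <= q].
Proof.
have /andP[e0 e1] := eta01; rewrite /q /qfactor.
by case: (leP eta (1 - eta)) => ?; split; lra.
Qed.

Lemma hlin_le y x : X y -> X x -> h y x <= Psif x.
Proof.
by move=> Xy Xx; rewrite /h /hlin lerD2r; exact: (composite_subgradient pb cf).
Qed.

Lemma Psi_le_hlin y x : X y -> X x ->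
  Psif x <= h y x + H / (1 + nu) * enorm (x - y) `^ (1 + nu).
Proof.
by move=> Xy Xx; have := composite_descent pb Xy Xx; rewrite /Psif /h /hlin /Psi; lra.
Qed.

Lemma hlin_convex y u v t : X u -> X v -> 0 <= t <= 1 ->
  h y ((1 - t) *: u + t *: v) <= (1 - t) * h y u + t * h y v.
Proof.
move=> Xu Xv t01; have [_ _ cchi _ _ _ _] := pb.
have := convex_functionP cchi Xu Xv t01.
rewrite /h /hlin; have -> : (1 - t) *: u + t *: v - y = (1 - t) *: (u - y) + t *: (v - y).
  by apply/rowP => i; rewrite !mxE; ring.
by rewrite (dotDr _ ((1 - t) *: _)) !dotZr; lra.
Qed.

Lemma diam_pow_ge x y : X x -> X y -> enorm (x - y) `^ (1 + nu) <= diam_pow X nu.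
Proof.
have [_ _ _ _ /andP[nu0 _] _ _] := pb.
have [M XM] := bounded_enorm bX => Xx Xy.
apply: ub_le_sup; last by exists x => //; exists y.
exists (M `^ (1 + nu)) => _ [u Xu [v Xv <-]].
by rewrite ge0_ler_powR ?nnegrE ?addr_ge0 ?enorm_ge0 ?XM// (le_trans (enorm_ge0 (u - v))) ?XM.
Qed.

(** If the optimal value exceeds the level, the cap by the level keeps the new bound valid;
    otherwise [xstar] lies in the localizer and the linearization there is at most Psi. An empty
    feasible set puts the minimum of the linearization, possibly +oo, at or above the level. *)
Lemma lower_bound_update s lbt :
  in_domain X s -> lbt%:E = maxe (lb s)%:E (mine (level eta s)%:E
    (hmin f df chi (loc s) (md_point alpha s))) ->
  [/\ lb s <= lbt,
     lb s <= Psif xstar -> (Psif xstar <= level eta s -> loc s xstar) ->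
       lbt <= Psif xstar
   & [set x | loc s x /\ h (md_point alpha s) x <= level eta s] = set0 ->
       level eta s <= lbt].
Proof.
move=> ds lbE; have [_ cX _ _ _ _ _] := pb; have [Xstar _] := minx.
have [_ _ _ _ locX] := ds.
have Xmd := md_point_in cX alpha01 ds.
split.
- by rewrite -lee_fin lbE le_max lexx.
- move=> lbs xs; rewrite -lee_fin lbE ge_max lee_fin lbs/= ge_min !lee_fin.
  have [/xs locs|/ltW -> //] := leP (Psif xstar) (level eta s).
  apply/orP; right; apply: (@le_trans _ _ (h (md_point alpha s) xstar)%:E).
    by apply: ereal_inf_lbound; exists xstar.
  by rewrite lee_fin hlin_le.
- move=> sub0; rewrite -lee_fin lbE le_max; apply/orP; right.
  rewrite le_min lexx/=; apply: le_ereal_inf_tmp => _ [x lx <-].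
  rewrite lee_fin leNgt; apply/negP => /ltW hx.
  by have : set0 x by rewrite -sub0.
Qed.

(** [pi_loc] is conditional because a localizer has to cover the level set only. *)
Record phase_inv s : Prop := PhaseInv {
  pi_dom : in_domain X s;
  pi_lb0 : lb0 s <= lb s;
  pi_lb : lb s <= Psif xstar;
  pi_ub0 : Psif (xhat s) <= ub0 s;
  pi_loc : Psif xstar <= level eta s -> loc s xstar
}.

Lemma phase_inv_gap s : phase_inv s -> lb0 s <= ub0 s.
Proof.
case=> [[_ Xh _ _ _] l0 l u0 _]; have [_ /(_ _ Xh) mx] := minx.
by rewrite (le_trans l0)// (le_trans l)// (le_trans mx).
Qed.

Lemma start_phase_inv i xa p lo s : X xa -> X p -> lo <= Psif xstar ->
  start_phase X f chi eta i xa p lo s -> phase_inv s.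
Proof.
move=> Xa Xp lox sp; have [Xstar _] := minx.
have ds := start_phase_in_domain Xa Xp sp.
have [[_ _ _ hE] [l0E u0E lE] _ _ [_ _ sublev _]] := sp.
split=> //; rewrite ?l0E ?lE ?u0E ?hE//.
by move=> xl; apply: sublev.
Qed.

(* If no point of the localizer satisfies h <= l, then the new lower bound is at
   least l and the phase ends; hence in an unfinished phase x_t is feasible. *)
Lemma iteration_inv k (gk : gstep) s s' : phase_inv s -> iter k gk s s' ->
  phase_inv s' /\
  ((exists lo, [/\ start_phase X f chi eta (phase s).+1 (xhat s') (xhat s') lo s',
      lo <= Psif (xhat s') & Psif (xhat s') - lo <= q * (ub0 s - lb0 s)])
   \/
   [/\ phase s' = phase s /\ inner s' = (inner s).+1, lb0 s' = lb0 s /\ ub0 s' = ub0 s,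
       q * (ub0 s' - lb0 s') < Psif (xhat s') - lb s',
       xorig s' = xorig s /\ loc s (xcur s') /\ h (md_point alpha s) (xcur s') <= level eta s
     & loc s' `<=` [set x | 0 <= dot (xcur s' - xorig s) (x - xcur s')] /\
       Psif (xhat s') <= Psif ((1 - alpha (inner s).+1) *: xhat s + alpha (inner s).+1 *: xcur s')]).
Proof.
move=> pinv it; have [ds l0 l u0 xloc] := pinv.
have [_ cX _ _ _ _ _] := pb; have [Xstar xmin] := minx.
have ds' := iteration_in_domain cX alpha01 ds it.
have [_ _ dec _] := iteration_decrease it.
have [_ Xh' _ _ _] := ds'.
move: it => [lbt [xt [xh [lbE [sub1 sub0] gs [xhE PE] stop]]]].
have [lb_le lb_star lb_sub0] := lower_bound_update ds lbE.
have lbt_star := lb_star l xloc.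
case: stop => [[[st1 st2] sp]|[nst [[phE inE xaE hE] oE cE [l0E u0E lE] [_ _ subl locl]]]].
  have hE : xhat s' = xh by case: sp => [[]].
  have Xxh : X xh by rewrite -hE.
  split; first exact: start_phase_inv sp.
  by left; exists lbt; rewrite hE.
have gap := phase_inv_gap pinv.
(* The first stopping condition always holds, since [lbt] is below the optimal value; hence the
   second one failed. *)
have nst' : q * (ub0 s - lb0 s) < Psif xh - lbt.
  rewrite ltNge; apply/negP => le; apply: nst; split=> //.
  by rewrite (le_trans lbt_star)// xmin// -hE.
split.
  split=> //; rewrite ?l0E ?u0E ?lE ?(le_trans l0)//.
    by rewrite hE -hE (le_trans dec).
  rewrite /level l0E u0E -/(level eta s) => xl; apply: subl; split; first exact: xloc.
  by rewrite (le_trans _ xl)//; exact: (hlin_le (md_point_in cX alpha01 ds) Xstar).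
right.
have [sub_0|/set0P/sub1[[loct ht] _]] := eqVneq
    [set x | loc s x /\ hlin f df chi (md_point alpha s) x <= level eta s] set0.
  (* Here the remaining gap is at most ub0 - l = eta (ub0 - lb0), which is within the stopping
     threshold. *)
  have := lb_sub0 sub_0; rewrite /level => lev; exfalso.
  have [q0 q1 q2 q3] := qfactor_bounds.
  have : eta * (ub0 s - lb0 s) <= q * (ub0 s - lb0 s) by rewrite ler_wpM2r// subr_ge0.
  move: dec; rewrite hE => dec.
  have : Psif xh <= ub0 s by rewrite (le_trans dec).
  lra.
rewrite cE oE hE l0E u0E lE; split=> //; split.
  by move=> x /locl[].
by rewrite /Psif PE !ge_min lexx ?orbT.
Qed.

End Phases.

(** * Number of phases and progress inside a phase *)

Lemma sqr_powR (R : realType) (d a : R) : 0 <= d -> (d ^+ 2) `^ (a / 2) = d `^ a.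
Proof. by move=> d0; rewrite -powR_mulrn// -powRrM mulrCA divff// mulr1. Qed.

(** For t = T + 1 and alpha_t = 2/(t+1), this bounds the Hoelder error multiplied by the weight
    t(t+1)/2. The right side is 2^nu t^(1-nu), written as a power of t^2 to fit the two-term Hoelder
    inequality. *)
Lemma weight_le (R : realType) (T nu : R) : 0 <= T -> 0 <= nu ->
  (T + 1) * (T + 2) / 2 * (2 / (T + 2)) `^ (1 + nu) <=
    2 `^ nu * ((T + 1) ^+ 2) `^ ((1 - nu) / 2).
Proof.
move=> T0 nu0; have T1 : 0 < T + 1 by rewrite ltr_wpDl.
have T2 : 0 < T + 2 by rewrite ltr_wpDl.
rewrite sqr_powR ?(ltW T1)// powRB ?(gt_eqF T1) ?implybT// powRr1 ?(ltW T1)//.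
have a0 : 0 < 2 / (T + 2) by rewrite divr_gt0.
rewrite [_ `^ (1 + nu)]powRD ?(gt_eqF a0) ?implybT// powRr1 ?(ltW a0)//.
have -> : (T + 1) * (T + 2) / 2 * (2 / (T + 2) * (2 / (T + 2)) `^ nu) =
  (T + 1) * (2 / (T + 2)) `^ nu by field; rewrite gt_eqF.
rewrite [leRHS]mulrCA ler_pM2l//.
have -> : 2 `^ nu / (T + 1) `^ nu = (2 / (T + 1)) `^ nu.
  rewrite powRM ?invr_ge0 ?(ltW T1)//; congr (_ * _).
  by rewrite -[X in _ = X `^ _]powR_inv1 ?(ltW T1)// -powRrM mulN1r powRN.
rewrite ge0_ler_powR ?nnegrE ?divr_ge0 ?(ltW T1) ?(ltW T2)//.
by rewrite ler_pM2l// lef_pV2 ?posrE// lerD2l ler1n.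
Qed.

Lemma cube_step (R : realType) (T : R) : 0 <= T ->
  T ^+ 3 + (T + 1) ^+ 2 <= (T + 1) ^+ 3.
Proof.
move=> T0; rewrite -subr_ge0.
have -> : (T + 1) ^+ 3 - (T ^+ 3 + (T + 1) ^+ 2) = 2 * T ^+ 2 + T by ring.
by rewrite addr_ge0// mulr_ge0// exprn_ge0.
Qed.

Section PhaseCount.
Context {R : realType} {n : nat}.
Variables (X : set 'rV[R]_n) (f : 'rV[R]_n -> R) (df : 'rV[R]_n -> 'rV[R]_n).
Variables (chi : 'rV[R]_n -> R) (nu H sigma gamma gamma2 eta : R) (alpha : nat -> R).
Variables (p0 : 'rV[R]_n) (st : nat -> @state R n) (g : nat -> @gstep R n).
Variables (xstar : 'rV[R]_n).
Hypothesis pb : composite_problem X f df chi nu H.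
Hypothesis bX : bounded_set X.
Hypothesis cf : convex_function X f.
Hypothesis minx : is_argmin X (Psi f chi) xstar.
Hypothesis run : uapl_run X f df chi sigma gamma gamma2 eta alpha p0 st g.

Let Psif := Psi f chi.
Let h := hlin f df chi.
Let q := qfactor eta.
Let gap (s : @state R n) := ub0 s - lb0 s.

Lemma run_phase_inv k : phase_inv X f chi eta xstar (st k).
Proof.
have [Xstar _] := minx.
have [Xp0 _ _ [p1 [Xp1 p1min] sp] it] := run.
elim: k => [|k IH].
  apply: (start_phase_inv minx) sp => //.
  by rewrite (le_trans (p1min _ Xstar))//; exact: (hlin_le pb cf).
by have [] := iteration_inv pb cf minx (let: And5 _ _ e _ _ := run in e) (run_alpha run) IH (it k).
Qed.

(** The initial gap Psi(p1) - h(p0, p1) is a linearization error, bounded through the diameter;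
    every finished phase contributes a factor [q]. *)
Lemma run_gap k : (0 < phase (st k))%N /\
  gap (st k) <= q ^+ (phase (st k)).-1 * (H * diam_pow X nu / (1 + nu)).
Proof.
have [Xp0 _ eta01 [p1 [Xp1 p1min] sp] it] := run.
have [_ _ _ H0 /andP[nu0 _] _ _] := pb.
elim: k => [|k [IH1 IH2]].
  have [[-> _ _ _] [l0E u0E _] _ _ _] := sp; split=> //.
  rewrite expr0 mul1r /gap l0E u0E lerBlDl.
  apply: (le_trans (Psi_le_hlin pb Xp0 Xp1)); rewrite lerD2l mulrAC.
  rewrite ler_wpM2r ?invr_ge0 ?addr_ge0// ler_pM2l//.
  exact: (diam_pow_ge pb bX Xp1 Xp0).
have [_ [[lo [sp' _ dec]]|[[-> _] [l0E u0E] _ _ _]]] :=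
  iteration_inv pb cf minx eta01 (run_alpha run) (run_phase_inv k) (it k).
  have [[-> _ _ _] [l0E u0E _] _ _ _] := sp'; split=> //.
  rewrite /gap l0E u0E (le_trans dec)//= -[X in q ^+ X](prednK IH1) exprS -mulrA.
  by have [q0 _ _ _] := qfactor_bounds eta01; rewrite ler_pM2l.
by rewrite /gap l0E u0E.
Qed.

Lemma nonsolution_gap eps k : ~ eps_solution X f chi xstar eps (xhat (st k)) ->
  eps < gap (st k).
Proof.
have [[_ Xh _ _ _] l0 l u0 _] := run_phase_inv k => ns.
have : eps < Psif (xhat (st k)) - Psif xstar.
  by rewrite ltNge; apply/negP => le; apply: ns.
by rewrite /gap /Psif; lra.
Qed.

Lemma phase_le eps k : 0 < eps ->
  ~ eps_solution X f chi xstar eps (xhat (st k)) ->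
  (phase (st k))%:Z <= phase_bound X nu H eta eps.
Proof.
move=> eps0 /nonsolution_gap lt_gap; have [ph0 gap_le] := run_gap k.
have [_ _ eta01 _ _] := run; have [q0 q1 _ _] := qfactor_bounds eta01.
have [_ _ _ H0 /andP[nu0 _] _ _] := pb.
have n0 : 0 < 1 + nu by rewrite ltr_pwDl.
set m := (phase (st k)).-1 in gap_le.
have lnq : 0 < ln q^-1 by rewrite ln_gt0// invf_gt1.
have E : H * diam_pow X nu / ((1 + nu) * eps) = (H * diam_pow X nu / (1 + nu)) / eps.
  by field; rewrite !gt_eqF.
have qm : q^-1 ^+ m < H * diam_pow X nu / ((1 + nu) * eps).
  rewrite E ltr_pdivlMr// exprVn -ltr_pdivlMl ?invr_gt0 ?exprn_gt0// invrK.
  exact: lt_le_trans lt_gap gap_le.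
have mlt : m%:R < ln (H * diam_pow X nu / ((1 + nu) * eps)) / ln q^-1.
  rewrite ltr_pdivlMr// mulr_natl -lnXn ?invr_gt0// ltr_ln// posrE ?exprn_gt0 ?invr_gt0//.
  by apply: lt_trans qm; rewrite exprn_gt0 ?invr_gt0.
have : m%:~R < (phase_bound X nu H eta eps)%:~R :> R.
  rewrite /phase_bound (lt_le_trans mlt)// (le_trans _ (ceil_ge _))//.
  by rewrite le_max lexx orbT.
(* Strictness matters: the phase number minus 1 is less than the integer bound, so the phase number
   is at most that bound. *)
by rewrite ltr_int -(prednK ph0) -/m -addn1 PoszD -lezD1 => /le_trans ->.
Qed.

Hypothesis alphaE : forall t : nat, (1 <= t)%N -> alpha t = 2 / (t.+1)%:R.

Let hc := H / (1 + nu).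

(* The factor t^3 bounds the sum of the weights tau^2 for tau <= t in Hoelder's
   inequality; it satisfies t^3 + (t+1)^2 <= (t+1)^3. *)
Record progress (s : @state R n) : Prop := Progress {
  pr_le : (inner s)%:R * (inner s).+1%:R / 2 * (Psif (xhat s) - level eta s) <=
    2 `^ nu * hc * (((inner s)%:R ^+ 3) `^ ((1 - nu) / 2) *
      (enorm (xcur s - xorig s) ^+ 2) `^ ((1 + nu) / 2));
  pr_loc : forall x, loc s x -> 0 <= dot (xcur s - xorig s) (x - xcur s);
  pr_gap : (0 < inner s)%N -> q * gap s < Psif (xhat s) - lb s
}.

Lemma start_phase_progress i xa p lo s :
  start_phase X f chi eta i xa p lo s -> progress s.
Proof.
move=> [[_ inE _ _] _ _ xE _]; have [_ _ _ H0 /andP[nu0 _] _ _] := pb.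
split; rewrite ?inE// xE subrr.
  have hc0 : 0 <= hc by rewrite divr_ge0 ?addr_ge0 ?(ltW H0).
  by rewrite !mul0r mulr_ge0 ?(mulr_ge0 _ hc0) ?mulr_ge0 ?powR_ge0.
by move=> x _; rewrite dot0l.
Qed.

(** Multiplied by t(t+1)/2, the recursion for Psi - l telescopes, and Hoelder's inequality merges
    each new error into the product kept by the invariant. *)
Lemma run_progress k : progress (st k).
Proof.
have [Xp0 _ eta01 [p1 [Xp1 p1min] sp] it] := run.
have [_ cX _ H0 /andP[nu0 nu1] _ _] := pb.
have n0 : 0 < 1 + nu by rewrite ltr_pwDl.
have hc0 : 0 <= hc by rewrite divr_ge0 ?ltW.
elim: k => [|k [IHle IHloc _]]; first exact: start_phase_progress sp.
have dk := run_in_domain pb run k; have dk1 := run_in_domain pb run k.+1.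
have [_ [[lo [sp' _ _]]|]] :=
  iteration_inv pb cf minx eta01 (run_alpha run) (run_phase_inv k) (it k).
  exact: start_phase_progress sp'.
set s := st k in IHle IHloc dk *; set s' := st k.+1 in dk1 *.
move=> [[_ inE] [l0E u0E] ngap [oE [loct ht]] [locE Pt]].
split; last by rewrite /gap.
  have [_ Xh Xc Xo _] := dk; have [_ _ Xc' _ _] := dk1.
  have Xmd := md_point_in cX (run_alpha run) dk.
  set T : R := (inner s)%:R; have T0 : 0 <= T by [].
  have T1 : 0 < T + 1 by rewrite ltr_wpDl.
  have T2 : 0 < T + 2 by rewrite ltr_wpDl.
  set a := alpha (inner s).+1 in Pt.
  have aE : a = 2 / (T + 2) by rewrite /a alphaE// -(addn2 (inner s)) natrD.
  have a01 : 0 <= a <= 1 by exact: (run_alpha run).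
  have levE : level eta s' = level eta s by rewrite /level l0E u0E.
  set d := enorm (xcur s' - xcur s).
  have Xt : X ((1 - a) *: xhat s + a *: xcur s') by exact: (convex_setP cX Xh Xc' a01).
  have mdE : (1 - a) *: xhat s + a *: xcur s' - md_point alpha s = a *: (xcur s' - xcur s).
    by rewrite /md_point -/a; apply/rowP => i; rewrite !mxE; ring.
  have h2 := Psi_le_hlin pb Xmd Xt.
  have h3 := hlin_convex pb (md_point alpha s) Xh Xc' a01.
  have h4 := hlin_le pb cf Xmd Xh.
  have a0 : 0 <= a by case/andP: a01.
  rewrite mdE enormZ (ger0_norm a0) -/d (powRM _ a0 (enorm_ge0 _)) in h2.
  set D := d `^ (1 + nu) in h2.
  (* Bound Psi at the averaged point by the linearization at x^md plus the Hoelder error, then use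
     convexity of the linearization, its bound by Psi at [xhat] and its bound by the level at
     x_t. *)
  have h5 : Psif (xhat s') - level eta s <=
      (1 - a) * (Psif (xhat s) - level eta s) + hc * (a `^ (1 + nu) * D).
    have : (1 - a) * h (md_point alpha s) (xhat s) <= (1 - a) * Psif (xhat s).
      by rewrite ler_wpM2l// subr_ge0; case/andP: a01.
    have : a * h (md_point alpha s) (xcur s') <= a * level eta s by rewrite ler_wpM2l.
    move: h2 h3 Pt; rewrite -/h -/hc -/Psif.
    set z1 := h _ _; set z2 := h _ _; set z3 := h _ _; lra.
  have wE : (inner s').+1%:R = T + 2 by rewrite inE -(addn2 (inner s)) natrD.
  have -> : (inner s')%:R = T + 1 by rewrite inE -addn1 natrD.
  rewrite levE wE oE.
  have h6 := weight_le T0 nu0; rewrite -aE in h6.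
  have w0 : 0 <= (T + 1) * (T + 2) / 2 by rewrite !mulr_ge0 ?invr_ge0 ?(ltW T1) ?(ltW T2).
  have D0 : 0 <= D by rewrite powR_ge0.
  (* The new weight times 1 - alpha_t is the old weight; this is the telescoping. *)
  have h7 : (T + 1) * (T + 2) / 2 * (1 - a) = T * (T + 1) / 2.
    by rewrite aE; field; rewrite gt_eqF.
  have h8 := ler_wpM2l w0 h5; apply: (le_trans h8).
  rewrite mulrDr [_ * ((1 - a) * _)]mulrA h7.
  have IHle' : T * (T + 1) / 2 * (Psif (xhat s) - level eta s) <=
    2 `^ nu * hc * ((T ^+ 3) `^ ((1 - nu) / 2) *
      (enorm (xcur s - xorig s) ^+ 2) `^ ((1 + nu) / 2)).
    by move: IHle; rewrite -addn1 natrD.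
  apply: (le_trans (lerD IHle' (lexx _))).
  set E := enorm (xcur s - xorig s) ^+ 2.
  have E0 : 0 <= E by rewrite exprn_ge0// enorm_ge0.
  have T1sq : 0 <= (T + 1) ^+ 2 by rewrite exprn_ge0// ltW.
  have dsq : 0 <= d ^+ 2 by rewrite exprn_ge0// enorm_ge0.
  have nua : 0 <= (1 - nu) / 2 by rewrite divr_ge0// subr_ge0.
  have nub : 0 < (1 + nu) / 2 by rewrite divr_gt0.
  have nuab : (1 - nu) / 2 + (1 + nu) / 2 = 1 by field.
  have hp := hoelder_pair (exprn_ge0 3 T0) T1sq E0 dsq nua nub nuab.
  have DE : (d ^+ 2) `^ ((1 + nu) / 2) = D by rewrite sqr_powR// enorm_ge0.
  rewrite DE in hp.
  (* x_t belongs to the previous localizer, hence to its half space, so the cross term is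
     nonnegative. *)
  have EE : E + d ^+ 2 <= enorm (xcur s' - xorig s) ^+ 2.
    have -> : xcur s' - xorig s = (xcur s - xorig s) + (xcur s' - xcur s).
      by apply/rowP => i; rewrite !mxE; ring.
    rewrite sqr_enormD lerD2r lerDl.
    by rewrite mulr_ge0// (IHloc _ loct).
  have hm : (T ^+ 3 + (T + 1) ^+ 2) `^ ((1 - nu) / 2) * (E + d ^+ 2) `^ ((1 + nu) / 2) <=
      ((T + 1) ^+ 3) `^ ((1 - nu) / 2) *
      (enorm (xcur s' - xorig s) ^+ 2) `^ ((1 + nu) / 2).
    apply: ler_pM; rewrite ?powR_ge0//.
      rewrite ge0_ler_powR ?nnegrE ?addr_ge0 ?exprn_ge0 ?(ltW T1)//.
      exact: cube_step.
    by rewrite ge0_ler_powR ?nnegrE ?addr_ge0 ?exprn_ge0 ?enorm_ge0 ?(ltW nub).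
  apply: (@le_trans _ _ (2 `^ nu * hc * ((T ^+ 3) `^ ((1 - nu) / 2) * E `^ ((1 + nu) / 2)
      + ((T + 1) ^+ 2) `^ ((1 - nu) / 2) * D))).
    rewrite [leRHS]mulrDr lerD2l.
    have -> : 2 `^ nu * hc * (((T + 1) ^+ 2) `^ ((1 - nu) / 2) * D) =
      2 `^ nu * ((T + 1) ^+ 2) `^ ((1 - nu) / 2) * (hc * D) by ring.
    have -> : (T + 1) * (T + 2) / 2 * (hc * (a `^ (1 + nu) * D)) =
      (T + 1) * (T + 2) / 2 * a `^ (1 + nu) * (hc * D) by ring.
    by rewrite ler_wpM2r// mulr_ge0.
  rewrite ler_wpM2l ?(mulr_ge0 (powR_ge0 _ _) hc0)//.
  exact: le_trans hp hm.
by move=> x /locE; rewrite oE.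
Qed.

End PhaseCount.

(** * Counting iterations *)

Section IterationCount.
Context {R : realType} {n : nat}.
Variables (X : set 'rV[R]_n) (f : 'rV[R]_n -> R) (df : 'rV[R]_n -> 'rV[R]_n).
Variables (chi : 'rV[R]_n -> R) (nu H sigma gamma gamma2 eta : R) (alpha : nat -> R).
Variables (p0 : 'rV[R]_n) (st : nat -> @state R n) (g : nat -> @gstep R n).
Variables (xstar : 'rV[R]_n).
Hypothesis pb : composite_problem X f df chi nu H.
Hypothesis bX : bounded_set X.
Hypothesis cf : convex_function X f.
Hypothesis minx : is_argmin X (Psi f chi) xstar.
Hypothesis run : uapl_run X f df chi sigma gamma gamma2 eta alpha p0 st g.

Let Psif := Psi f chi.
Let q := qfactor eta.
Let gap (s : @state R n) := ub0 s - lb0 s.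

Hypothesis alphaE : forall t : nat, (1 <= t)%N -> alpha t = 2 / (t.+1)%:R.

Let r := 2 / (3 * nu + 1).
Let c := 4 * Num.sqrt 3 * H * diam_pow X nu / (eta * 2^-1 * (1 + nu)).

Lemma c_ge0 : 0 <= c.
Proof.
have [Xp0 _ /andP[e0 _] _ _] := run; have [_ _ _ H0 /andP[nu0 _] _ _] := pb.
have D0 : 0 <= diam_pow X nu.
  by apply: le_trans (diam_pow_ge pb bX Xp0 Xp0); exact: powR_ge0.
rewrite /c divr_ge0 ?mulr_ge0 ?sqrtr_ge0 ?(ltW H0) ?(ltW e0)//.
by rewrite addr_ge0.
Qed.

(** As long as the phase is unfinished, Psi - l stays at least (eta/2) times the phase gap. Against
    the decay given by [run_progress] this bounds the inner counter. *)
Lemma inner_le k : 0 < gap (st k) -> (inner (st k))%:R <= (c / gap (st k)) `^ r.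
Proof.
move=> gap0; have [_ _ eta01 _ _] := run; have /andP[e0 e1] := eta01.
have [_ _ _ H0 /andP[nu0 nu1] _ _] := pb.
have [[_ _ Xc Xo _] l0 _ _ _] := run_phase_inv pb cf minx run k.
have [prle _ prgap] := run_progress pb cf minx run alphaE k.
have [q0 q1 q2 _] := qfactor_bounds eta01.
have [->|t0] := posnP (inner (st k)); first exact: powR_ge0.
set s := st k in gap0 Xc Xo l0 prle prgap t0 *.
set T : R := (inner s)%:R in prle *.
have T0 : 0 < T by rewrite ltr0n.
have n1 : 0 < 1 + nu by rewrite ltr_pwDl.
have n3 : 0 < 3 * nu + 1 by rewrite ltr_wpDl// mulr_ge0.
have lev : eta / 2 * gap s <= Psif (xhat s) - level eta s.
  have : (1 - eta / 2) * gap s <= q * gap s by rewrite ler_pM2r.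
  by have := prgap t0; rewrite /gap /level -/Psif -/q; lra.
have D_le : (enorm (xcur s - xorig s) ^+ 2) `^ ((1 + nu) / 2) <= diam_pow X nu.
  by rewrite sqr_powR ?enorm_ge0//; exact: diam_pow_ge pb bX _ _ Xc Xo.
have hc0 : 0 < H / (1 + nu) by rewrite divr_gt0.
set D := diam_pow X nu in D_le.
have D0 : 0 <= D by rewrite (le_trans _ D_le)// powR_ge0.
set y := (T ^+ 3) `^ ((1 - nu) / 2) in prle.
have y0 : 0 < y by rewrite powR_gt0// exprn_gt0.
(* The factor [y] also appears in the progress bound and cancels, leaving the exponent (3 nu +
   1)/2. *)
have TE : T ^+ 2 = y * T `^ ((3 * nu + 1) / 2).
  rewrite /y -(powR_mulrn 3 (ltW T0)) -powRrM -powRD ?(gt_eqF T0) ?implybT//.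
  have -> : 3 * ((1 - nu) / 2) + (3 * nu + 1) / 2 = 2%:R :> R by field.
  by rewrite powR_mulrn ?(ltW T0).
have pow2 : 2 `^ nu <= 2 :> R by rewrite ler1_powR// ler1n.
have s3 : 1 <= Num.sqrt 3 :> R by rewrite -[leLHS]sqrtr1 ler_wsqrtr// ler1n.
have key : T `^ ((3 * nu + 1) / 2) <= c / gap s.
  rewrite ler_pdivlMr// /c ler_pdivlMr ?mulr_gt0 ?invr_gt0//.
  rewrite -(ler_pM2l y0).
  have step1 : T ^+ 2 / 2 * (eta / 2 * gap s) <= 2 * (H / (1 + nu)) * (y * D).
    apply: (@le_trans _ _ (T * (inner s).+1%:R / 2 * (Psif (xhat s) - level eta s))).
      apply: ler_pM => //.
      - by rewrite divr_ge0// exprn_ge0// ltW.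
      - by rewrite !mulr_ge0// ltW.
      - by rewrite ler_pM2r ?invr_gt0// expr2 ler_pM2l// ler_nat.
    apply: (le_trans prle); apply: ler_pM; rewrite ?mulr_ge0 ?powR_ge0 ?(ltW y0) ?(ltW H0) ?invr_ge0 ?(ltW n1)//.
      by rewrite ler_pM2r.
    by rewrite ler_pM2l.
  (* The estimate itself has the factor 4, which is enlarged to the stated one. *)
  have step2 : 4 * H * (y * D) <= 4 * Num.sqrt 3 * H * (y * D).
    rewrite ler_wpM2r ?mulr_ge0 ?(ltW y0)// ler_pM2r// ler_peMr//.
  have n2 : 0 < 2 * (1 + nu) by rewrite mulr_gt0.
  rewrite TE -(ler_pM2r n2) in step1.
  set Z := T `^ _ in step1 *.
  have -> : y * (Z * gap s * (eta / 2 * (1 + nu))) =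
      y * Z / 2 * (eta / 2 * gap s) * (2 * (1 + nu)) by field.
  apply: (le_trans step1).
  have -> : 2 * (H / (1 + nu)) * (y * D) * (2 * (1 + nu)) = 4 * H * (y * D).
    by field; rewrite gt_eqF.
  by apply: (le_trans step2); rewrite -/D [leRHS]mulrCA.
have r0 : 0 <= r by rewrite divr_ge0// ltW.
have -> : T = (T `^ ((3 * nu + 1) / 2)) `^ r.
  rewrite -powRrM /r; have -> : (3 * nu + 1) / 2 * (2 / (3 * nu + 1)) = 1.
    by field; rewrite gt_eqF.
  by rewrite powRr1 ?ltW.
by rewrite (ge0_ler_powR r0) ?nnegrE ?powR_ge0 ?(divr_ge0 c_ge0 (ltW gap0)).
Qed.

Lemma qr_bounds : 0 < q `^ r < 1.
Proof.
have [_ _ eta01 _ _] := run; have [q0 q1 _ _] := qfactor_bounds eta01.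
have [_ _ _ H0 /andP[nu0 nu1] _ _] := pb.
have n3 : 0 < 3 * nu + 1 by rewrite ltr_wpDl// mulr_ge0.
rewrite powR_gt0//= -[ltRHS](_ : 1 `^ r = 1); last by rewrite powR1.
by rewrite gt0_ltr_powR ?nnegrE ?(ltW q0)// divr_gt0.
Qed.

(* The last term bounds the geometric series over the earlier phases, whose gaps
   are at least gap / q, gap / q^2, ... *)
Lemma run_count k : 0 < gap (st k) ->
  k%:R <= (phase (st k)).-1%:R + (inner (st k))%:R +
    (c / gap (st k)) `^ r * (q `^ r / (1 - q `^ r)).
Proof.
have [Xp0 _ eta01 [p1 [Xp1 p1min] sp] it] := run.
have [q0 q1 _ _] := qfactor_bounds eta01; have /andP[qr0 qr1] := qr_bounds.
have w1 : 0 < 1 - q `^ r by rewrite subr_gt0.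
have [_ _ _ H0 /andP[nu0 nu1] _ _] := pb.
have n3 : 0 < 3 * nu + 1 by rewrite ltr_wpDl// mulr_ge0.
elim: k => [|k IH] gap0.
  by rewrite !addr_ge0// mulr_ge0 ?powR_ge0// divr_ge0 ?(ltW qr0) ?(ltW w1).
have [ph0 _] := run_gap pb bX cf minx run k.
have [_ [[lo [sp' _ dec]]|[[phE inE] [l0E u0E] _ _ _]]] :=
  iteration_inv pb cf minx eta01 (run_alpha run) (run_phase_inv pb cf minx run k) (it k);
  last first.
  move: gap0; rewrite phE inE /gap l0E u0E -[k.+1]addn1 -[(inner _).+1]addn1 !natrD => gap0.
  by have := IH gap0; rewrite /gap; lra.
have [[phE inE _ _] [l0E u0E _] _ _ _] := sp'.
have gap_le : gap (st k.+1) <= q * gap (st k) by rewrite /gap l0E u0E.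
have gap0' : 0 < gap (st k) by rewrite -(pmulr_rgt0 _ q0) (lt_le_trans gap0).
have := IH gap0'; have := inner_le gap0'.
rewrite phE inE addr0 /=.
set x := (c / gap (st k)) `^ r; set y := (c / gap (st k.+1)) `^ r.
have xy : x <= y * q `^ r.
  have r0 : 0 <= r by rewrite divr_ge0 ?(ltW n3).
  have cg0 := divr_ge0 c_ge0 (ltW gap0); have cg0' := divr_ge0 c_ge0 (ltW gap0').
  rewrite /y -(powRM _ cg0 (ltW q0)).
  rewrite (ge0_ler_powR r0) ?nnegrE ?(mulr_ge0 cg0 (ltW q0))//.
  rewrite -[leRHS]mulrA (ler_wpM2l c_ge0)// ler_pdivlMl// ler_pdivrMr//.
(* The weight w = q^r/(1 - q^r) solves (1 + w) q^r = w, so the inner iterations [x] of the finished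
   phase are absorbed into the tail attached to the new gap. The closing iteration is counted by the
   phase number. *)
have xw : x + x * (q `^ r / (1 - q `^ r)) = x / (1 - q `^ r) by field; rewrite gt_eqF.
have yw : x / (1 - q `^ r) <= y * (q `^ r / (1 - q `^ r)).
  by rewrite mulrA ler_pM2r ?invr_gt0.
have -> : (phase (st k))%:R = (phase (st k)).-1%:R + 1 :> R by rewrite natr1 prednK.
by rewrite -natr1; lra.
Qed.

Lemma iteration_bound (eps : R) : 0 < eps ->
  exists2 K : nat,
    K%:R <= (phase_bound X nu H eta eps)%:~R + (1 - q `^ r)^-1 * (c / eps) `^ r
    & eps_solution X f chi xstar eps (xhat (st K)).
Proof.
move=> eps0; have /andP[qr0 qr1] := qr_bounds.
have w1 : 0 < 1 - q `^ r by rewrite subr_gt0.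
have [_ _ _ H0 /andP[nu0 nu1] _ _] := pb.
have n3 : 0 < 3 * nu + 1 by rewrite ltr_wpDl// mulr_ge0.
set B := _ + _.
(* The extra 1 in [k.+1] compensates the predecessor of the phase number in [run_count]. *)
have nonsol k : ~ eps_solution X f chi xstar eps (xhat (st k)) -> k.+1%:R <= B.
  move=> ns; have lt_gap := nonsolution_gap pb cf minx run ns.
  have gap0 : 0 < gap (st k) by exact: lt_trans lt_gap.
  have [ph0 _] := run_gap pb bX cf minx run k.
  have := phase_le pb bX cf minx run eps0 ns; rewrite -(ler_int R) => ph.
  have cnt := run_count gap0; have inn := inner_le gap0.
  have : (c / gap (st k)) `^ r / (1 - q `^ r) <= (c / eps) `^ r / (1 - q `^ r).
    rewrite ler_pM2r ?invr_gt0// ge0_ler_powR ?nnegrE ?(divr_ge0 c_ge0) ?divr_ge0 ?(ltW n3) ?(ltW eps0) ?(ltW gap0)//.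
    by rewrite (ler_wpM2l c_ge0)// lef_pV2 ?posrE// ltW.
  set x := (c / _) `^ r in cnt inn *; set y := (c / _) `^ r.
  have xw : x + x * (q `^ r / (1 - q `^ r)) = x / (1 - q `^ r) by field; rewrite gt_eqF.
  rewrite -/y => xy; rewrite /B -/y [_^-1 * _]mulrC -natr1.
  have : (phase (st k)).-1%:R + 1 <= (phase_bound X nu H eta eps)%:~R :> R.
    by rewrite natr1 prednK.
  lra.
have B0 : 0 <= B.
  rewrite addr_ge0 ?mulr_ge0 ?powR_ge0 ?invr_ge0 ?(ltW w1)//.
  by rewrite ler0z -[leLHS](ceil0 R) le_ceil// le_max lexx.
(* Without a solution at an index at most [B], induction would put every natural number below [B];
   the base case uses [0 <= B]. *)
apply: contrapT => none.
have all_ns k : k%:R <= B /\ ~ eps_solution X f chi xstar eps (xhat (st k)).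
  elim: k => [|k [_ /nonsol IH]]; first by split=> // sol; apply: none; exists 0%N.
  by split=> // sol; apply: none; exists k.+1.
have [+ _] := all_ns (Num.bound B); rewrite leNgt => /negP; apply.
exact: archi_boundP.
Qed.

End IterationCount.

Theorem theorem7 (R : realType) (nu sigma gamma gamma2 : R)
    (hnu : 0 <= nu <= 1) (hgamma : 0 < gamma) (hgs : gamma < sigma)
    (hsigma : sigma < 1) (hgamma2 : 0 < gamma2 < 1) :
  (* (a) *)
  (0 < nu ->
   exists2 C : R, 0 < C &
   forall (n : nat) (X : set 'rV[R]_n) (f : 'rV[R]_n -> R)
     (df : 'rV[R]_n -> 'rV[R]_n) (chi : 'rV[R]_n -> R) (H eta : R)
     (alpha : nat -> R) (p0 : 'rV[R]_n) (st : nat -> state)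
     (g : nat -> gstep) (eps : R),
     composite_problem X f df chi nu H -> bounded_set X ->
     has_lbound [set Psi f chi x | x in X] ->
     uapl_run X f df chi sigma gamma gamma2 eta alpha p0 st g ->
     (forall k, (1 <= k)%N ->
        (2 * sigma - gamma) / Lconst nu H <= gs_hbeta (g k)) ->
     0 < eps ->
     exists k : nat,
       [/\ (1 <= k)%N,
           k%:Z <= Num.ceil (C * H `^ nu^-1 *
             ((Psi f chi p0 - Psi_opt X f chi + 1) / eps)
               `^ ((1 + nu) / (2 * nu)))
         & enorm (proj_grad gamma2 st g k) ^+ 2 <= eps])
  /\
  (* (b) *)
  (forall (n : nat) (X : set 'rV[R]_n) (f : 'rV[R]_n -> R)
     (df : 'rV[R]_n -> 'rV[R]_n) (chi : 'rV[R]_n -> R) (H eta : R)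
     (alpha : nat -> R) (p0 : 'rV[R]_n) (st : nat -> state)
     (g : nat -> gstep) (eps : R) (xstar : 'rV[R]_n),
     composite_problem X f df chi nu H -> bounded_set X ->
     convex_function X f ->
     is_argmin X (Psi f chi) xstar ->
     uapl_run X f df chi sigma gamma gamma2 eta alpha p0 st g ->
     0 < eps ->
     let S := phase_bound X nu H eta eps in
     let q := qfactor eta in
     let theta : R := 2^-1 in
     (forall k : nat,
        ~ eps_solution X f chi xstar eps (xhat (st k)) ->
        (phase (st k))%:Z <= S)
     /\
     ((forall t : nat, (1 <= t)%N -> alpha t = 2 / (t.+1)%:R) ->
      exists2 K : nat,
        K%:R <= S%:~R +
          (1 - q `^ (2 / (3 * nu + 1)))^-1 *
          (4 * Num.sqrt 3 * H * diam_pow X nu /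
             (eta * theta * (1 + nu) * eps)) `^ (2 / (3 * nu + 1))
        & eps_solution X f chi xstar eps (xhat (st K)))).
Proof.
split=> [nu0|].
  have nu01 : 0 < nu <= 1 by rewrite nu0; case/andP: hnu.
  have g2 : 0 < gamma2 <= 1 by case/andP: hgamma2 => -> /ltW.
  have [C C0 hC] := proj_grad_complexity nu01 hgamma hgs g2.
  by exists C => // n X f df chi H eta alpha p0 st g eps pb _; exact: hC.
move=> n X f df chi H eta alpha p0 st g eps xstar pb bX cf minx run eps0 S q theta.
split=> [k ns|alphaE]; first exact: (phase_le pb bX cf minx run eps0 ns).
have [K KB sol] := iteration_bound pb bX cf minx run alphaE eps0.
exists K => //; apply: (le_trans KB); rewrite /theta.
have -> : 4 * Num.sqrt 3 * H * diam_pow X nu / (eta * 2^-1 * (1 + nu) * eps) =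
    4 * Num.sqrt 3 * H * diam_pow X nu / (eta * 2^-1 * (1 + nu)) / eps.
  by rewrite invfM mulrA.
exact: lexx.
Qed.
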